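(* Let $f$ and $g$ be distinct bicritical rational maps of even degree $d$, neither of which is a power map. If there exists $k\in\mathbb{N}$ such that $f^k = g^k$, then $f^2 = g^2$. Furthermore, there exists a Möbius involution $\mu$ such that $g = \mu\circ f = f\circ \mu$; in particular $\mu$ is a nontrivial element of both $\mathrm{Aut}(f)$ and $\mathrm{Aut}(g)$, so $f$ and $g$ belong to the symmetry locus $\Sigma_d$.
   Context: A rational map of degree $d\ge2$ is bicritical if it has exactly two critical points. A power map is a rational map Möbius-conjugate to $z\mapsto z^d$ or $z\mapsto z^{-d}$ (equivalently, a bicritical map whose critical point set equals its critical value set). For a rational map $f$, $\mathrm{Aut}(f)$ is the group of Möbius transformations $\tau$ with $\tau\circ f = f\circ \tau$. The symmetry locus $\Sigma_d$ is the set of degree $d$ bicritical rational maps $f$ with $\mathrm{Aut}(f)$ nontrivial. $f^k$ denotes the $k$-th iterate. *)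

(* Defs.v *)
(* The Riemann sphere over C is modelled as [option C]
   ([None] = infinity) with C := R[i] for R : realType (any realType is
   the real line up to isomorphism, so R[i] is the complex field). *)
From mathcomp Require Import all_boot all_algebra.
From mathcomp Require Import reals complex.
Set Implicit Arguments. Unset Strict Implicit. Unset Printing Implicit Defensive.
Import GRing.Theory.
Local Open Scope ring_scope.

Definition sphere (K : Type) := option K.

Section RatMaps.
Variable K : fieldType.

Definition rdeg (P Q : {poly K}) : nat := (maxn (size P) (size Q)).-1.

Definition reval (P Q : {poly K}) (z : sphere K) : sphere K :=
  match z with
  | Some x => if Q.[x] == 0 then None else Some (P.[x] / Q.[x])
  | None => let d := rdeg P Q in
            if Q`_d == 0 then None else Some (P`_d / Q`_d)
  end.

(* polynomial whose roots (with multiplicity, in the affine chart, and with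
   the deficit of degree counted at infinity) form the fiber over w *)
Definition fiberpoly (P Q : {poly K}) (w : sphere K) : {poly K} :=
  match w with Some a => P - a%:P * Q | None => Q end.

Definition locdeg (P Q : {poly K}) (z : sphere K) : nat :=
  match z with
  | Some x => mup x (fiberpoly P Q (reval P Q z))
  | None => ((rdeg P Q).+1 - size (fiberpoly P Q (reval P Q None)))%N
  end.

Definition is_ratmap (d : nat) (f : sphere K -> sphere K) : Prop :=
  exists P Q : {poly K}, coprimep P Q /\ rdeg P Q = d /\
    forall z, f z = reval P Q z.

Definition is_critical (f : sphere K -> sphere K) (z : sphere K) : Prop :=
  exists P Q : {poly K}, coprimep P Q /\ (forall w, f w = reval P Q w) /\
    (1 < locdeg P Q z)%N.

Definition bicritical (d : nat) (f : sphere K -> sphere K) : Prop :=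
  is_ratmap d f /\
  exists c1 c2, c1 <> c2 /\ forall z, is_critical f z <-> (z = c1 \/ z = c2).

Definition is_mobius (m : sphere K -> sphere K) : Prop := is_ratmap 1 m.

Definition power_map (d : nat) (f : sphere K -> sphere K) : Prop :=
  exists m, is_mobius m /\
    ((forall z, f (m z) = m (reval 'X^d 1 z)) \/
     (forall z, f (m z) = m (reval 1 'X^d z))).

Definition in_Aut (f tau : sphere K -> sphere K) : Prop :=
  is_mobius tau /\ forall z, tau (f z) = f (tau z).

Definition symmetry_locus (d : nat) (f : sphere K -> sphere K) : Prop :=
  bicritical d f /\ exists tau, in_Aut f tau /\ ~ (forall z, tau z = z).

End RatMaps.

(* Main.v *)
(* Two facts carry the proof.  First, if [p], [q] are coprime polynomials, not both constant, at
   most three forms [b p - a q] are squares (descent).  A critical value of [g] is a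
   value over which [g^k = f^k] has only even multiplicities, and so, unless it is critical for
   [f], are all its [f]-preimages for [f^(k-1)]; hence [f] and [g] have the same critical values
   [V], except possibly when [d = 2], [f V_f] is a point of [V_g] and [g V_g] a point of [V_f].
   In that case [f^2] and [g^2] are Klein four-group quotients with the same critical values,
   which forces the postcritical set of [f] to be [V_f -> t -> y -> y], leaving finitely many
   cross-ratios, none of which suits [g] too.

   Secondly, once [V_f = V_g] we have [g = f M] with [M] a Moebius map, and cancelling [f] on the
   left in [f^k = (f M)^k] lets us choose [M] so that [(M f)^k = f^k].  So [M] preserves [V], hence
   [M f = f N], and [N] can be chosen with [(N f)^k = f^k]; it preserves [V] and the set [C] of
   critical points, so it is an involution because [C <> V].  Since [d] is even, [N] cannot fix the
   points of [C] unless [f N = f].  Iterating, [N f = f N'] where [N] and [N'] both exchange the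
   points of [C] and those of [V], so [N = N'] and therefore [M = N]. *)
Require Import Defs.
From mathcomp Require Import all_boot all_algebra.
From mathcomp Require Import reals complex.
From mathcomp Require Import separable cyclotomic ring zify.
Set Implicit Arguments. Unset Strict Implicit. Unset Printing Implicit Defensive.
Import GRing.Theory Num.Theory.
Local Open Scope ring_scope.

(** * The sphere and Moebius maps *)

Section Sphere.
Variable K : numClosedFieldType.
Implicit Types (u v x : K) (z : sphere K) (m n : sphere K -> sphere K).

(** The point with homogeneous coordinates [u : v]. At [(0, 0)] it takes the default value infinity,
    so most of its laws are stated under [nz]. *)
Definition pt u v : sphere K := if v == 0 then None else Some (u / v).
(* Homogeneous coordinates: [z = pt (hn z) (hd z)], infinity being [pt 1 0]. *)
Definition hn z : K := if z is Some x then x else 1.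
Definition hd z : K := if z is Some _ then 1 else 0.
Definition nz u v := (u != 0) || (v != 0).
Definition s0 : sphere K := Some 0.
Definition s1 : sphere K := Some 1.
Definition soo : sphere K := None.

Lemma pt_h z : pt (hn z) (hd z) = z.
Proof. by case: z => [x|]; rewrite /pt /= ?oner_eq0 ?eqxx ?divr1. Qed.

Lemma nz_h z : nz (hn z) (hd z).
Proof. by case: z => [x|]; rewrite /nz /= oner_eq0 ?orbT. Qed.

Lemma nzE u v : nz u v <-> (u = 0 -> v = 0 -> False).
Proof.
rewrite /nz; split=> [/orP[] /eqP // H *|H]; apply/negPn; rewrite negb_or !negbK.
by apply/negP => /andP[/eqP u0 /eqP v0]; apply: H.
Qed.

Lemma pt_eq u v u' v' : nz u v -> nz u' v' ->
  pt u v = pt u' v' <-> u * v' = u' * v.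
Proof.
rewrite /pt /nz; have [->|v0] := eqVneq v 0; have [->|v0'] := eqVneq v' 0 => /=;
  rewrite ?orbF ?mulr0.
- by [].
- by move=> u0 _; split=> // /eqP; rewrite mulf_eq0 (negPf u0) (negPf v0').
- by move=> _ u0; split=> // /eqP; rewrite eq_sym mulf_eq0 (negPf u0) (negPf v0).
- move=> _ _; split=> [[H]|H].
    by rewrite -[u](divfK v0) H; field.
  by congr Some; apply: (mulIf v0); apply: (mulIf v0'); rewrite divfK // H; field.
Qed.

Lemma pt01 : pt 0 1 = s0.
Proof. by rewrite /pt oner_eq0 mul0r. Qed.

Lemma pt10 : pt 1 0 = soo.
Proof. by rewrite /pt eqxx. Qed.

Lemma ptZ c u v : c != 0 -> pt (c * u) (c * v) = pt u v.
Proof.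
move=> c0; rewrite /pt mulf_eq0 (negPf c0) /=; case: eqP => // /eqP v0.
by congr Some; field; rewrite v0 c0.
Qed.

Lemma pt_lift u v : nz u v -> exists2 c, c != 0 &
  (u = c * hn (pt u v)) /\ (v = c * hd (pt u v)).
Proof.
rewrite /pt /nz; have [->|v0] := eqVneq v 0.
  by rewrite orbF => u0; exists u => //=; rewrite mulr1 mulr0.
by move=> _; exists v => //=; rewrite mulr1; split=> //; rewrite mulrC divfK.
Qed.

Lemma h_neq z z' : z <> z' -> hn z * hd z' - hn z' * hd z != 0.
Proof.
move=> ne; apply/eqP => /eqP; rewrite subr_eq0 => /eqP H; apply: ne.
by rewrite -(pt_h z) -(pt_h z'); apply/pt_eq => //; apply: nz_h.
Qed.

Definition mob (a b c e : K) z : sphere K :=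
  pt (a * hn z + b * hd z) (c * hn z + e * hd z).

Definition Mob m := exists a b c e, a * e - b * c != 0 /\ forall z, m z = mob a b c e z.

Lemma mob_pt a b c e u v : nz u v ->
  mob a b c e (pt u v) = pt (a * u + b * v) (c * u + e * v).
Proof.
move=> /pt_lift[k k0 []]; move: (pt u v) => z -> ->.
by rewrite /mob -(ptZ _ _ k0); congr pt; ring.
Qed.

Lemma nz_lin a b c e u v : a * e - b * c != 0 -> nz u v ->
  nz (a * u + b * v) (c * u + e * v).
Proof.
move=> D /nzE H; apply/nzE => H1 H2; apply: H; apply: (mulfI D); rewrite mulr0.
  transitivity (e * (a * u + b * v) - b * (c * u + e * v)); first by ring.
  by rewrite H1 H2; ring.
transitivity (a * (c * u + e * v) - c * (a * u + b * v)); first by ring.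
by rewrite H1 H2; ring.
Qed.

Lemma Mob_mob a b c e : a * e - b * c != 0 -> Mob (mob a b c e).
Proof. by move=> D; exists a, b, c, e. Qed.

Lemma Mob_id : Mob id.
Proof.
exists 1, 0, 0, 1; split=> [|z]; first by rewrite mulr1 mul0r subr0 oner_eq0.
by rewrite /mob !mul1r !mul0r addr0 add0r pt_h.
Qed.

Lemma Mob_comp m n : Mob m -> Mob n -> Mob (fun z => m (n z)).
Proof.
move=> [a [b [c [e [D E]]]]] [a' [b' [c' [e' [D' E']]]]].
exists (a*a'+b*c'), (a*b'+b*e'), (c*a'+e*c'), (c*b'+e*e'); split.
  have -> : (a*a'+b*c')*(c*b'+e*e') - (a*b'+b*e')*(c*a'+e*c') =
    (a * e - b * c) * (a' * e' - b' * c') by ring.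
  by rewrite mulf_neq0.
move=> z; rewrite E E' {2}/mob mob_pt; last exact: nz_lin (nz_h z).
by rewrite /mob; congr pt; ring.
Qed.

Lemma Mob_inv m : Mob m -> exists n, [/\ Mob n, cancel m n & cancel n m].
Proof.
move=> [a [b [c [e [D E]]]]]; exists (mob e (-b) (-c) a).
have D' : e * a - - b * - c != 0 by rewrite mulrNN mulrC.
split; first exact: Mob_mob.
  move=> z; rewrite E mob_pt; last exact: nz_lin (nz_h z).
  rewrite -[RHS]pt_h -[RHS](ptZ _ _ D); congr pt; ring.
move=> z; rewrite E mob_pt; last exact: nz_lin (nz_h z).
rewrite -[RHS]pt_h -[RHS](ptZ _ _ D); congr pt; ring.
Qed.

Lemma Mob_inj m : Mob m -> injective m.
Proof. by move=> /Mob_inv[n [_ mn _]]; apply: can_inj mn. Qed.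

Lemma Mob_surj m : Mob m -> forall w, exists z, m z = w.
Proof. by move=> /Mob_inv[n [_ _ nm]] w; exists (n w). Qed.

(* A fixed point of [mob a b c e] is a zero of the quadratic form
   [c u^2 + (e - a) u v - b v^2]. *)
Lemma Mob_fix3 m z1 z2 z3 : Mob m -> z1 <> z2 -> z1 <> z3 -> z2 <> z3 ->
  m z1 = z1 -> m z2 = z2 -> m z3 = z3 -> forall z, m z = z.
Proof.
move=> [a [b [c [e [D E]]]]] n12 n13 n23.
have fixE z : m z = z <-> (a * hn z + b * hd z) * hd z = hn z * (c * hn z + e * hd z).
  rewrite E /mob -[X in _ = X <-> _]pt_h.
  by apply: pt_eq; [exact: nz_lin (nz_h z)|exact: nz_h].
move=> /fixE F1 /fixE F2 /fixE F3 z; apply/fixE; move: F1 F2 F3.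
have := h_neq n12; have := h_neq n13; have := h_neq n23.
move: (hn z1) (hd z1) (hn z2) (hd z2) (hn z3) (hd z3) (hn z) (hd z).
move=> u1 v1 u2 v2 u3 v3 u v d23 d13 d12 F1 F2 F3.
have DD : (u1*v2-u2*v1)*(u1*v3-u3*v1)*(u2*v3-u3*v2) != 0 by rewrite !mulf_neq0.
pose q u v := (a * u + b * v) * v - u * (c * u + e * v).
have Q1 : q u1 v1 = 0 by rewrite /q F1 subrr.
have Q2 : q u2 v2 = 0 by rewrite /q F2 subrr.
have Q3 : q u3 v3 = 0 by rewrite /q F3 subrr.
apply/eqP; rewrite -subr_eq0; apply/eqP; apply: (mulfI DD); rewrite mulr0.
(* Lagrange interpolation of the form at three points *)
transitivity ((u2*v3-u3*v2)*(u*v2-u2*v)*(u*v3-u3*v) * q u1 v1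
  - (u1*v3-u3*v1)*(u*v1-u1*v)*(u*v3-u3*v) * q u2 v2
  + (u1*v2-u2*v1)*(u*v1-u1*v)*(u*v2-u2*v) * q u3 v3); last by rewrite Q1 Q2 Q3; ring.
by rewrite /q; ring.
Qed.

Lemma Mob_eq3 m n z1 z2 z3 : Mob m -> Mob n -> z1 <> z2 -> z1 <> z3 -> z2 <> z3 ->
  m z1 = n z1 -> m z2 = n z2 -> m z3 = n z3 -> forall z, m z = n z.
Proof.
move=> Mm Mn n12 n13 n23 E1 E2 E3 z; have [n' [Mn' nn' n'n]] := Mob_inv Mn.
have := @Mob_fix3 (fun z => n' (m z)) z1 z2 z3 (Mob_comp Mn' Mm) n12 n13 n23.
rewrite E1 E2 E3 !nn' => H; have {}H := H erefl erefl erefl z.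
by rewrite -[LHS]n'n H.
Qed.

(** * Inversion, scalings and power maps *)

Definition sinv := mob 0 1 1 0.
Definition scal w := mob w 0 0 1.

Lemma Mob_sinv : Mob sinv.
Proof. by apply: Mob_mob; rewrite mul0r mulr1 sub0r oppr_eq0 oner_eq0. Qed.

Lemma Mob_scal w : w != 0 -> Mob (scal w).
Proof. by move=> w0; apply: Mob_mob; rewrite mulr1 mul0r subr0. Qed.

Lemma sinv_pt u v : nz u v -> sinv (pt u v) = pt v u.
Proof. by move=> H; rewrite /sinv mob_pt //; congr pt; ring. Qed.

Lemma scal_pt w u v : nz u v -> scal w (pt u v) = pt (w * u) v.
Proof. by move=> H; rewrite /scal mob_pt //; congr pt; ring. Qed.

Lemma sinv0 : sinv s0 = soo.
Proof. by rewrite /sinv /scal /mob /pt /= !(mul1r, mulr1, mul0r, mulr0, addr0, add0r) ?eqxx ?oner_eq0 ?mul0r ?divr1 //. Qed.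
Lemma sinvoo : sinv soo = s0.
Proof. by rewrite /sinv /scal /mob /pt /= !(mul1r, mulr1, mul0r, mulr0, addr0, add0r) ?eqxx ?oner_eq0 ?mul0r ?divr1 //. Qed.
Lemma sinvK z : sinv (sinv z) = z.
Proof.
rewrite -[z]pt_h !sinv_pt ?nz_h //.
by have := nz_h z; rewrite /nz orbC.
Qed.
Lemma scal0 w : scal w s0 = s0.
Proof. by rewrite /sinv /scal /mob /pt /= !(mul1r, mulr1, mul0r, mulr0, addr0, add0r) ?eqxx ?oner_eq0 ?mul0r ?divr1 //. Qed.
Lemma scaloo w : scal w soo = soo.
Proof. by rewrite /sinv /scal /mob /pt /= !(mul1r, mulr1, mul0r, mulr0, addr0, add0r) ?eqxx ?oner_eq0 ?mul0r ?divr1 //. Qed.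
Lemma scal_some w x : scal w (Some x) = Some (w * x).
Proof. by rewrite /sinv /scal /mob /pt /= !(mul1r, mulr1, mul0r, mulr0, addr0, add0r) ?eqxx ?oner_eq0 ?mul0r ?divr1 //. Qed.

Definition powS d z : sphere K := if z is Some x then Some (x ^+ d) else None.

Lemma pow_pt d u v : (0 < d)%N -> nz u v -> powS d (pt u v) = pt (u ^+ d) (v ^+ d).
Proof.
move=> d0 _; rewrite /pt expf_eq0 d0 /=; case: eqP => //= _.
by rewrite expr_div_n.
Qed.

Lemma nz_pow d u v : nz u v -> nz (u ^+ d) (v ^+ d).
Proof. by rewrite /nz => /orP[] H; rewrite (expf_neq0 _ H) ?orbT. Qed.

Lemma pow0 d : (0 < d)%N -> powS d s0 = s0.
Proof. by case: d => // d _; rewrite /s0 /= expr0n. Qed.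

Lemma rootK d x : (0 < d)%N -> exists y, y ^+ d = x.
Proof. by move=> d0; exists (d.-root x); rewrite rootCK. Qed.

Lemma pow_surj d w : (0 < d)%N -> exists z, powS d z = w.
Proof.
move=> d0; case: w => [x|]; last by exists None.
by have [y <-] := rootK x d0; exists (Some y).
Qed.

Lemma pow_sinv d z : (0 < d)%N -> powS d (sinv z) = sinv (powS d z).
Proof.
move=> d0; rewrite -[z]pt_h; have Nz := nz_h z.
have Nz' : nz (hd z) (hn z) by rewrite /nz orbC.
by rewrite sinv_pt // !pow_pt // sinv_pt // nz_pow.
Qed.

Lemma pow_scal d w z : (0 < d)%N -> powS d (scal w z) = scal (w ^+ d) (powS d z).
Proof.
by case: z => [x|] d0; rewrite ?scaloo // scal_some /= scal_some exprMn.
Qed.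

Lemma pow_is0 d z : (0 < d)%N -> powS d z = s0 -> z = s0.
Proof. by case: z => [x|] // d0 [] /eqP; rewrite expf_eq0 d0 /= => /eqP ->. Qed.

Lemma pow_isoo d z : powS d z = soo -> z = soo.
Proof. by case: z. Qed.

Lemma Mob_fix0oo m : Mob m -> m s0 = s0 -> m soo = soo ->
  exists2 w, w != 0 & forall z, m z = scal w z.
Proof.
move=> Mm m0 moo; case E: (m s1) => [w|]; last first.
  by have := Mob_inj Mm (etrans E (esym moo)).
have w0 : w != 0.
  apply/eqP => w0; have := Mob_inj Mm (etrans E (etrans (congr1 Some w0) (esym m0))).
  by case=> /eqP; rewrite oner_eq0.
exists w => //; apply: (@Mob_eq3 _ _ s0 soo s1) => //; rewrite ?scal0 ?scaloo //.
- exact: Mob_scal.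
- by case=> /eqP; rewrite eq_sym oner_eq0.
- by rewrite scal_some mulr1 E.
Qed.

Lemma Mob_swap0oo m : Mob m -> m s0 = soo -> m soo = s0 ->
  exists2 w, w != 0 & forall z, m z = scal w (sinv z).
Proof.
move=> Mm m0 moo.
have [||w w0 H] := @Mob_fix0oo (fun z => m (sinv z)) (Mob_comp Mm Mob_sinv).
- by rewrite sinv0.
- by rewrite sinvoo.
by exists w => // z; rewrite -H sinvK.
Qed.

End Sphere.

(** * Square forms *)

Section Poly.
Variable K : numClosedFieldType.
Implicit Types (p q r : {poly K}) (u v x : K) (z t : sphere K).
Implicit Types (phi psi m : sphere K -> sphere K).

(** In characteristic zero [1, ..., size p] are [size p] distinct nonzero roots, more than the
    degree allows. Leaving out [0] serves the comparison at infinity in [ratl_eq]. *)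
Lemma poly_cofinite_eq0 p : (forall x, x != 0 -> p.[x] = 0) -> p = 0.
Proof.
move=> H; apply/eqP/negPn/negP => p0.
have := @max_poly_roots _ p [seq i.+1%:R | i <- iota 0 (size p)] p0.
rewrite size_map size_iota ltnn => F; suff : false by []; apply: F.
  by apply/allP => _ /mapP[i _ ->]; apply/rootP/H; rewrite pnatr_eq0.
rewrite map_inj_uniq ?iota_uniq // => i j /eqP.
by rewrite eqr_nat => /eqP[].
Qed.

Lemma poly_fun_inj p q : (forall x, p.[x] = q.[x]) -> p = q.
Proof.
move=> H; apply/eqP; rewrite -subr_eq0; apply/eqP/poly_cofinite_eq0 => x _.
by rewrite !hornerE H subrr.
Qed.

Lemma sqrtK x : exists y, y ^+ 2 = x.
Proof. exact: rootK. Qed.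

Definition sq p := exists r, p = r ^+ 2.

Lemma sqZ c p : c != 0 -> sq (c *: p) <-> sq p.
Proof.
move=> c0; have [s s2] := sqrtK c; have s0 : s != 0.
  by apply: contraNneq c0 => s0; rewrite -s2 s0 expr0n.
split=> -[r Hr].
  exists (s^-1 *: r); rewrite exprZn -Hr scalerA -s2 exprVn mulVf ?scale1r //.
  by rewrite expf_neq0.
by exists (s *: r); rewrite exprZn s2 Hr.
Qed.

Lemma sq_const p : (size p <= 1)%N -> sq p.
Proof.
move=> /size1_polyC ->; have [s <-] := sqrtK p`_0.
by exists s%:P; rewrite rmorphXn.
Qed.

Lemma sq_mul p q : sq p -> sq q -> sq (p * q).
Proof. by move=> [r ->] [s ->]; exists (r * s); rewrite exprMn. Qed.

Lemma sq_size r : r != 0 -> size (r ^+ 2) = ((size r).-1 * 2).+1.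
Proof. by move=> r0; rewrite -size_exp; rewrite prednK // size_poly_gt0 expf_neq0. Qed.

(** Induction on the size of [r]: a root of [r] is a root of exactly one factor, which is then
    divisible by the square of the linear polynomial. Constants are squares because [K] is
    algebraically closed. *)
Lemma sq_coprime p q : coprimep p q -> sq (p * q) -> sq p.
Proof.
move=> + [r]; have [->|r0] := eqVneq r 0.
  rewrite expr0n /= => cpq /eqP; rewrite mulf_eq0 => /orP[] /eqP E.
    by exists 0; rewrite E expr0n.
  by apply: sq_const; move: cpq; rewrite E coprimep0 -size_poly_eq1 => /eqP ->.
have [n] := ubnP (size r); elim: n => // n IH in p q r r0 *.
rewrite ltnS => szr cpq E.
have pq0 : p * q != 0 by rewrite E expf_neq0.
have p0 : p != 0 by apply: contraNneq pq0 => ->; rewrite mul0r.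
have q0 : q != 0 by apply: contraNneq pq0 => ->; rewrite mulr0.
have [sr1|] := eqVneq (size r) 1.
  apply: sq_const; have := congr1 (fun x : {poly K} => size x) E; rewrite sq_size // sr1 size_mul //=.
  move: q0; rewrite -size_poly_gt0; case: (size q) => // m _.
  by rewrite addnS /= mul0n => <-; rewrite leq_addr.
move=> /closed_rootP[a ra].
have /factor_theorem[r1 Er] := ra.
have r10 : r1 != 0 by apply: contraNneq r0 => r10; rewrite Er r10 mul0r.
have X0 : 'X - a%:P != 0 by rewrite polyXsubC_eq0.
have X20 : ('X - a%:P) ^+ 2 != 0 by rewrite expf_neq0.
have szr1 : (size r1 < n)%N.
  by move: szr; rewrite Er size_mul // size_XsubC addn2.
have rpq : root p a || root q a.
  by rewrite -rootM E rootE hornerE (rootP ra) expr0n.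
have D : ('X - a%:P) ^+ 2 %| p * q by rewrite E Er exprMn dvdp_mull.
case/orP: rpq => [rp|rq].
  have nq := coprimep_root cpq rp.
  have cX : coprimep (('X - a%:P) ^+ 2) q.
    by rewrite coprimep_expl // coprimep_sym coprimep_XsubC.
  move: D; rewrite Gauss_dvdpl // => /dvdpP[p1 Ep].
  have c1 : coprimep p1 q by move: cpq; rewrite Ep coprimepMl => /andP[].
  have E1 : p1 * q = r1 ^+ 2.
    by apply: (mulIf X20); rewrite -exprMn -Er -E Ep; ring.
  have [s Es] := IH _ _ _ r10 szr1 c1 E1.
  by exists (s * ('X - a%:P)); rewrite Ep Es exprMn.
have np : p.[a] != 0 by apply: (coprimep_root _ rq); rewrite coprimep_sym.
have cX : coprimep (('X - a%:P) ^+ 2) p.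
  by rewrite coprimep_expl // coprimep_sym coprimep_XsubC.
move: D; rewrite Gauss_dvdpr // => /dvdpP[q1 Eq].
have c1 : coprimep p q1 by move: cpq; rewrite Eq coprimepMr => /andP[].
apply: (IH p q1 r1) => //.
by apply: (mulIf X20); rewrite -exprMn -Er -E Eq; ring.
Qed.

(** The member of the pencil of [p] and [q] whose zeros form the affine fibre of [p / q] over
    [pt u v]. *)
Definition lin p q u v := v *: p - u *: q.

Lemma lin_lin p q a b c e u v :
  lin (a *: p + b *: q) (c *: p + e *: q) (a * u + b * v) (c * u + e * v) =
  (a * e - b * c) *: lin p q u v.
Proof. by rewrite /lin -!mul_polyC !(rmorphB, rmorphD, rmorphM) /=; ring. Qed.

Definition fullp p q t := sq (lin p q (hn t) (hd t)).

Lemma fullp_pt p q u v : nz u v -> fullp p q (pt u v) <-> sq (lin p q u v).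
Proof.
move=> /pt_lift[k k0 []]; move: (pt u v) => z -> ->.
by rewrite /lin -[_ *: p]scalerA -[_ *: q]scalerA -scalerBr sqZ.
Qed.

Lemma fullp_mob p q a b c e t : a * e - b * c != 0 ->
  fullp (a *: p + b *: q) (c *: p + e *: q) (mob a b c e t) <-> fullp p q t.
Proof.
move=> D; rewrite fullp_pt ?lin_lin ?sqZ //.
exact: nz_lin (nz_h t).
Qed.

Lemma coprime_lin p q a b c e : a * e - b * c != 0 -> coprimep p q ->
  coprimep (a *: p + b *: q) (c *: p + e *: q).
Proof.
move=> D /Bezout_eq1_coprimepP[[u v] /= E]; apply/Bezout_eq1_coprimepP.
pose w := (a * e - b * c)^-1.
exists (w%:P * (e%:P * u - c%:P * v), w%:P * (a%:P * v - b%:P * u)) => /=.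
transitivity ((w * (a * e - b * c))%:P * (u * p + v * q)).
  by rewrite -!mul_polyC !(rmorphB, rmorphD, rmorphM) /=; ring.
by rewrite E mulVf // mulr1.
Qed.

Lemma coprime_nz p q x : coprimep p q -> nz p.[x] q.[x].
Proof.
move=> c; rewrite /nz; have [px|//] := eqVneq p.[x] 0.
by rewrite (coprimep_root c) //; apply/rootP.
Qed.

Lemma coprime_lin2 p q u v u' v' : u * v' - u' * v != 0 -> coprimep p q ->
  coprimep (lin p q u v) (lin p q u' v').
Proof.
move=> D c; have := @coprime_lin p q v (-u) v' (-u') _ c.
rewrite /lin !scaleNr; apply.
by move: D; congr (_ != 0); ring.
Qed.

(* Descent: after a change of coordinates two of the four forms are [p = u^2]
   and [q = - v^2], and the other two split into four forms in [u] and [v]. *)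
Lemma four_squares p q t1 t2 t3 t4 : coprimep p q -> uniq [:: t1; t2; t3; t4] ->
  fullp p q t1 -> fullp p q t2 -> fullp p q t3 -> fullp p q t4 ->
  (size p <= 1)%N /\ (size q <= 1)%N.
Proof.
have [n] := ubnP (maxn (size p) (size q)).
elim: n => // n IH in p q t1 t2 t3 t4 *.
rewrite ltnS geq_max => /andP[szp szq] cpq ut F1 F2 F3 F4.
have [n1|n1] := leqP n 1; first by rewrite !(leq_trans _ n1).
have ne i j : (i < j < 4)%N -> nth t1 [:: t1; t2; t3; t4] i <> nth t1 [:: t1; t2; t3; t4] j.
  case/andP => ij j4; apply/eqP; rewrite nth_uniq ?(ltn_trans ij) //.
  by rewrite neq_ltn ij.
have n12 := ne 0 1 isT; have n13 := ne 0 2 isT; have n14 := ne 0 3 isT.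
have n23 := ne 1 2 isT; have n24 := ne 1 3 isT; have n34 := ne 2 3 isT.
rewrite /= in n12 n13 n14 n23 n24 n34.
pose a := hd t1; pose b := - hn t1; pose c := hd t2; pose e := - hn t2.
have D : a * e - b * c != 0.
  by have := h_neq n12; congr (_ != 0); rewrite /a /b /c /e; ring.
pose m := mob a b c e; have Mm : Mob m := Mob_mob D.
have m1 : m t1 = s0 K.
  rewrite -pt01; apply/pt_eq; rewrite ?nz_lin ?nz_h //; first by rewrite /nz oner_eq0 orbT.
  by rewrite /a /b; ring.
have m2 : m t2 = soo K.
  rewrite -pt10; apply/pt_eq; rewrite ?nz_lin ?nz_h //; first by rewrite /nz oner_eq0.
  by rewrite /c /e; ring.
have [c3 c30 m3] : exists2 c3, c3 != 0 & m t3 = Some c3.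
  case E: (m t3) => [c3|]; last by have := Mob_inj Mm (etrans E (esym m2)) => /esym.
  exists c3 => //; apply/eqP => c0; apply: n13; apply: (Mob_inj Mm).
  by rewrite m1 E c0.
have [c4 c40 m4] : exists2 c4, c4 != 0 & m t4 = Some c4.
  case E: (m t4) => [c4|]; last by have := Mob_inj Mm (etrans E (esym m2)) => /esym.
  exists c4 => //; apply/eqP => c0; apply: n14; apply: (Mob_inj Mm).
  by rewrite m1 E c0.
have c34 : c3 != c4.
  by apply/eqP => c34; apply: n34; apply: (Mob_inj Mm); rewrite m3 m4 c34.
pose P := a *: p + b *: q; pose Q := c *: p + e *: q.
have [U HU] : sq P by rewrite /P /b scaleNr; exact: F1.
have [V HV] : sq Q by rewrite /Q /e scaleNr; exact: F2.
have cPQ : coprimep P Q by apply: coprime_lin.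
have cUV : coprimep U V.
  by move: cPQ; rewrite HU HV coprimep_pexpl // coprimep_pexpr.
have szP : (size P <= n)%N.
  by rewrite (leq_trans (size_polyD _ _)) // geq_max !(leq_trans (size_scale_leq _ _)).
have szQ : (size Q <= n)%N.
  by rewrite (leq_trans (size_polyD _ _)) // geq_max !(leq_trans (size_scale_leq _ _)).
(* A nonzero square of a polynomial of size [s] has size [2 s - 1], so passing to [U] and [V] lowers
   the bound; for constants this uses [1 < n]. *)
have small (W : {poly K}) : (size (W ^+ 2) <= n)%N -> (size W < n)%N.
  have [->|W0] := eqVneq W 0; first by rewrite size_poly0 => _; apply: ltnW.
  by rewrite sq_size //; lia.
(* [P - cc Q = (U - s V) (U + s V)], and the factors are coprime since [2 s] is nonzero. *)
have split cc s : s ^+ 2 = cc -> cc != 0 -> sq (lin P Q cc 1) ->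
    fullp U V (Some s) /\ fullp U V (Some (- s)).
  move=> s2 cc0; have s0 : s != 0 by apply: contraNneq cc0 => s0; rewrite -s2 s0 expr0n.
  have -> : lin P Q cc 1 = lin U V s 1 * lin U V (- s) 1.
    by rewrite /lin HU HV -s2 -!mul_polyC !(rmorphN, rmorphXn, rmorph1) /=; ring.
  have cl : coprimep (lin U V s 1) (lin U V (- s) 1).
    apply: coprime_lin2 => //; have -> : s * 1 - - s * 1 = s *+ 2 by ring.
    by rewrite mulrn_eq0.
  by move=> H; split; [apply: sq_coprime H|apply: (@sq_coprime _ (lin U V s 1)); rewrite 1?coprimep_sym // mulrC].
have [r3 e3] := sqrtK c3; have [r4 e4] := sqrtK c4.
have [G1 G2] : fullp U V (Some r3) /\ fullp U V (Some (- r3)).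
  apply: (split c3) => //; have : fullp P Q (m t3) by apply/fullp_mob.
  by rewrite m3.
have [G3 G4] : fullp U V (Some r4) /\ fullp U V (Some (- r4)).
  apply: (split c4) => //; have : fullp P Q (m t4) by apply/fullp_mob.
  by rewrite m4.
have nr x : x ^+ 2 != 0 -> x != - x.
  by rewrite expf_eq0 -[x == - x]subr_eq0 opprK -mulr2n mulrn_eq0.
have nrr x y : x ^+ 2 != y ^+ 2 -> (x != y) && (x != - y).
  by rewrite eqf_sqr negb_or.
have /andP[k1 k2] : (r3 != r4) && (r3 != - r4) by apply: nrr; rewrite e3 e4.
have [szU szV] : (size U <= 1)%N /\ (size V <= 1)%N.
  apply: (IH U V (Some r3) (Some (- r3)) (Some r4) (Some (- r4))) => //.
    by rewrite gtn_max !small -?HU -?HV.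
  rewrite /= !inE !(inj_eq Some_inj) !negb_or k1 k2 !nr ?e3 ?e4 //=.
  by rewrite eqr_oppLR k2 eqr_opp k1.
have [u Eu] : exists u, P = u%:P.
  by exists (U`_0 ^+ 2); rewrite HU (size1_polyC szU) coefC /= rmorphXn.
have [v Ev] : exists v, Q = v%:P.
  by exists (V`_0 ^+ 2); rewrite HV (size1_polyC szV) coefC /= rmorphXn.
have Ep : (a * e - b * c) *: p = (e * u - b * v)%:P.
  by rewrite rmorphB !rmorphM /= -Eu -Ev /P /Q -!mul_polyC rmorphB !rmorphM /=; ring.
have Eq : (a * e - b * c) *: q = (a * v - c * u)%:P.
  by rewrite rmorphB !rmorphM /= -Eu -Ev /P /Q -!mul_polyC rmorphB !rmorphM /=; ring.
by rewrite -(size_scale p D) -(size_scale q D) Ep Eq !size_polyC_leq1.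
Qed.

End Poly.

(** * Rational maps and square fibres *)

Section Rational.
Variable K : numClosedFieldType.
Implicit Types (p q r : {poly K}) (u v x : K) (z t : sphere K).
Implicit Types (phi psi m : sphere K -> sphere K).

Local Notation s0 := (s0 K).
Local Notation s1 := (s1 K).
Local Notation soo := (soo K).

Definition rep phi p q :=
  coprimep p q /\ forall x, phi (Some x) = pt p.[x] q.[x].

Lemma rep_cross phi p q p' q' :
  rep phi p q -> rep phi p' q' -> p * q' = p' * q.
Proof.
move=> [c E] [c' E']; apply: poly_fun_inj => x; rewrite !hornerE.
by apply/pt_eq; rewrite ?coprime_nz // -E -E'.
Qed.

(** With [u p + v q = 1], the polynomial [w = u p' + v q'] satisfies [p' = w p] and [q' = w q]; it
    divides the coprime [p'] and [q'], so it is constant. *)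
Lemma rep_uniq phi p q p' q' : rep phi p q -> rep phi p' q' ->
  exists2 c : K, c != 0 & p' = c *: p /\ q' = c *: q.
Proof.
move=> R R'; have E := rep_cross R R'; case: R R' => [c _] [c' _].
have [[u v] /= B] := Bezout_eq1_coprimepP _ _ c.
pose w := u * p' + v * q'.
have Ep : p' = w * p.
  by rewrite -[LHS]mulr1 -B /w mulrDr mulrDl mulrAC mulrCA [p' * _]mulrCA -E; ring.
have Eq : q' = w * q.
  by rewrite -[LHS]mulr1 -B /w mulrDr mulrDl -[u * p' * q]mulrA -E; ring.
have : size w == 1.
  rewrite size_poly_eq1; move/coprimepP: c' => -> //.
    by rewrite Ep dvdp_mulr.
  by rewrite Eq dvdp_mulr.
move=> /eqP sz; have w0 : w`_0 != 0.
  by apply/eqP => w0; have := size1_polyC (eq_leq sz); rewrite w0 => W;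
     move: sz; rewrite W size_poly0.
by exists w`_0 => //; rewrite Ep Eq -!mul_polyC -size1_polyC ?sz.
Qed.

Lemma rep_mob a b c e phi p q : a * e - b * c != 0 -> rep phi p q ->
  rep (fun z => mob a b c e (phi z)) (a *: p + b *: q) (c *: p + e *: q).
Proof.
move=> D [cpq E]; split=> [|x]; first exact: coprime_lin.
by rewrite E mob_pt ?coprime_nz // !hornerE.
Qed.

Lemma rep_pow d phi p q : (0 < d)%N -> rep phi p q ->
  rep (fun z => powS d (phi z)) (p ^+ d) (q ^+ d).
Proof.
move=> d0 [cpq E]; split=> [|x]; first by rewrite coprimep_expl // coprimep_expr.
by rewrite E pow_pt ?coprime_nz // !horner_exp.
Qed.

(* [rep] only sees the affine chart; the second clause is the chart at infinity. *)
Definition ratl phi := (exists p q, rep phi p q) /\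
  (exists p q, rep (fun z => phi (sinv z)) p q).

Lemma ratl_mob m phi : Mob m -> ratl phi -> ratl (fun z => m (phi z)).
Proof.
move=> [a [b [c [e [D E]]]]] [[p [q R]] [p' [q' R']]]; split.
  by do 2!eexists; have [C H] := rep_mob D R; split; [exact: C|move=> x; rewrite E].
by do 2!eexists; have [C H] := rep_mob D R'; split; [exact: C|move=> x; rewrite E].
Qed.

Lemma ratl_pow d phi : (0 < d)%N -> ratl phi -> ratl (fun z => powS d (phi z)).
Proof.
move=> d0 [[p [q R]] [p' [q' R']]].
by split; do 2!eexists; [exact: rep_pow d0 R|exact: rep_pow d0 R'].
Qed.

Lemma rep_id : rep (@id (sphere K)) 'X 1.
Proof. by split=> [|x]; rewrite ?coprimep1 // !hornerE /pt oner_eq0 divr1. Qed.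

Lemma ratl_id : ratl id.
Proof.
split; first by exists 'X, 1; apply: rep_id.
exists (0 *: 'X + 1 *: 1), (1 *: 'X + 0 *: 1).
by apply: rep_mob rep_id; rewrite mul0r mulr1 sub0r oppr_eq0 oner_eq0.
Qed.

Lemma ratl_ext phi psi : (forall z, psi z = phi z) -> ratl phi -> ratl psi.
Proof.
by move=> E [[p [q [c R]]] [p' [q' [c' R']]]]; split; [exists p, q|exists p', q'];
  split=> // x; rewrite E.
Qed.

(** Infinity is compared in the other chart: the cross difference of the representatives vanishes at
    every nonzero point, hence identically, hence at [0]. *)
Lemma ratl_eq phi psi : ratl phi -> ratl psi ->
  (forall x, phi (Some x) = psi (Some x)) -> forall z, phi z = psi z.
Proof.
move=> [_ [p [q [c R]]]] [_ [p' [q' [c' R']]]] H [x|] //.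
have inv00 : soo = sinv (Some 0) by rewrite sinv0.
rewrite [None]inv00 R R'; apply/pt_eq; rewrite ?coprime_nz // -!hornerM.
congr (_.[0]); apply/eqP; rewrite -subr_eq0; apply/eqP/poly_cofinite_eq0 => x x0.
rewrite !hornerE; apply/eqP; rewrite subr_eq0; apply/eqP.
apply/pt_eq; rewrite ?coprime_nz // -R -R'.
have -> : sinv (Some x) = Some x^-1 by rewrite -[Some x]pt_h sinv_pt ?nz_h // /pt /= (negPf x0) div1r.
exact: H.
Qed.

Lemma unity_roots d : (0 < d)%N -> exists rs : seq K,
  {in rs, forall w, w ^+ d = 1} /\
  forall x y : K, x ^+ d = y ^+ d -> exists2 w, w \in rs & x = w * y.
Proof.
move=> d0; have [rs Ers] := closed_field_poly_normal ('X^d - 1 : {poly K}).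
have lc : lead_coef ('X^d - 1 : {poly K}) != 0.
  by rewrite lead_coef_eq0 -size_poly_eq0 size_XnsubC.
have rsE w : (w \in rs) = (w ^+ d == 1).
  by rewrite -root_prod_XsubC -(rootZ _ _ lc) -Ers /root !hornerE subr_eq0.
exists rs; split=> [w|x y]; first by rewrite rsE => /eqP.
have [->|y0] := eqVneq y 0.
  rewrite expr0n eqn0Ngt d0 /= => /eqP; rewrite expf_eq0 d0 /= => /eqP ->.
  by exists 1; rewrite ?rsE ?expr1n // mulr0.
move=> E; exists (x / y); last by rewrite divfK.
by rewrite rsE expr_div_n E divff // expf_neq0.
Qed.

(** One root of unity has to serve all points at once. The product of the [p q' - w p' q] over the
    roots of unity [w] vanishes everywhere, so one factor is the zero polynomial. *)
Lemma pow_eq d phi psi : (0 < d)%N -> ratl phi -> ratl psi ->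
  (forall z, powS d (phi z) = powS d (psi z)) ->
  exists2 w, w ^+ d = 1 & forall z, phi z = scal w (psi z).
Proof.
move=> d0 Rp Rs H; have [[p [q R]] _] := Rp; have [[p' [q' R']] _] := Rs.
have [rs [rs1 Hrs]] := unity_roots d0.
have E : \prod_(w <- rs) (p * q' - w *: (p' * q)) = 0.
  apply: poly_fun_inj => x; rewrite horner0 horner_prod.
  have [|w win Ew] := Hrs (p.[x] * q'.[x]) (p'.[x] * q.[x]).
    rewrite !exprMn; apply/pt_eq; rewrite ?nz_pow ?coprime_nz ?R.1 ?R'.1 //.
    by rewrite -!pow_pt ?coprime_nz ?R.1 ?R'.1 // -R.2 -R'.2 H.
  by apply/eqP; rewrite prodf_seq_eq0; apply/hasP; exists w => //=; rewrite hornerD hornerN hornerZ !hornerM Ew subrr.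
move: E => /eqP; rewrite prodf_seq_eq0 => /hasP[w win /= /eqP /subr0_eq Ew].
have fin x : p.[x] * q'.[x] = w * (p'.[x] * q.[x]).
  by rewrite -hornerM Ew hornerZ hornerM.
have w1 := rs1 w win; have w0 : w != 0.
  by apply/eqP => w0; move: w1; rewrite w0 expr0n eqn0Ngt d0 => /eqP; rewrite eq_sym oner_eq0.
exists w => //; apply: ratl_eq => //; first exact: ratl_mob (Mob_scal w0) Rs.
move=> x; rewrite R.2 R'.2 scal_pt ?coprime_nz ?R'.1 //.
apply/pt_eq; rewrite ?coprime_nz ?R.1 //; last by rewrite fin mulrA.
by have := coprime_nz x R'.1; rewrite /nz mulf_eq0 negb_or w0.
Qed.

(* The fibre of [phi] over [t] has only even multiplicities in the affine chart. *)
Definition full phi t := exists p q, rep phi p q /\ fullp p q t.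

Lemma full_rep phi p q t : rep phi p q -> full phi t -> fullp p q t.
Proof.
move=> R [p' [q' [R']]]; have [c c0 [-> ->]] := rep_uniq R R'.
by rewrite /fullp /lin !scalerA mulrC [_ * c]mulrC -!scalerA -scalerBr sqZ.
Qed.

Lemma full_ext phi psi t : (forall z, psi z = phi z) -> full phi t -> full psi t.
Proof.
by move=> E [p [q [[c R] F]]]; exists p, q; split=> //; split=> // x; rewrite E.
Qed.

Lemma full_mob m phi t : Mob m -> ratl phi ->
  full (fun z => m (phi z)) (m t) <-> full phi t.
Proof.
move=> [a [b [c [e [D E]]]]] [[p [q R]] _]; have R' := rep_mob D R.
have Rm : rep (fun z => m (phi z)) (a *: p + b *: q) (c *: p + e *: q).
  by split=> [|x]; [exact: R'.1|rewrite E; exact: R'.2].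
split=> [/(full_rep Rm)|/(full_rep R)] F.
  by exists p, q; split=> //; move: F; rewrite E fullp_mob.
by do 2!eexists; split; [exact: Rm|rewrite E fullp_mob].
Qed.

Definition onto phi := forall w, exists z, phi z = w.

Lemma s01 : s0 <> s1.
Proof. by case=> /eqP; rewrite eq_sym oner_eq0. Qed.

Lemma rep_const phi p q : rep phi p q -> (size p <= 1)%N -> (size q <= 1)%N ->
  ~ onto phi.
Proof.
move=> [_ R] /size1_polyC Ep /size1_polyC Eq surj.
have cst x : phi (Some x) = pt p`_0 q`_0 by rewrite R Ep Eq !hornerC !coefC.
have inf w : w <> pt p`_0 q`_0 -> phi soo = w.
  have [[x|] <-] := surj w => ne; last by [].
  by case: ne; rewrite cst.
have [E0|/eqP/inf E0] := eqVneq s0 (pt p`_0 q`_0).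
  have E1 := inf s1; have Eoo := inf soo; rewrite -E0 in E1 Eoo.
  by have := E1 (nesym s01); rewrite Eoo.
have [E1|/eqP/inf E1] := eqVneq s1 (pt p`_0 q`_0).
  by have Eoo := inf soo; rewrite -E1 E0 in Eoo; case: Eoo.
by case: s01; rewrite -E0 -E1.
Qed.

Lemma four_full phi t1 t2 t3 t4 : ratl phi -> onto phi -> uniq [:: t1; t2; t3; t4] ->
  full phi t1 -> full phi t2 -> full phi t3 -> full phi t4 -> False.
Proof.
move=> [[p [q R]] _] surj u /(full_rep R) F1 /(full_rep R) F2 /(full_rep R) F3 /(full_rep R) F4.
have [szp szq] := four_squares R.1 u F1 F2 F3 F4.
exact: rep_const R szp szq surj.
Qed.

(** At a zero of [p - x q] its cofactor in [p^d - x^d q^d] equals [d (x q)^(d-1)], which is nonzero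
    there. The two factors are thus coprime and [sq_coprime] applies. *)
Lemma full_pow_desc d phi z : (0 < d)%N -> ratl phi -> z <> s0 -> z <> soo ->
  full (fun w => powS d (phi w)) (powS d z) -> full phi z.
Proof.
move=> d0 [[p [q R]] _]; case: z => // x x0 _ /(full_rep (rep_pow d0 R)) F.
have {}x0 : x != 0 by apply/eqP => E; apply: x0; rewrite E.
exists p, q; split=> //; move: F; rewrite /fullp /lin /= !scale1r.
have -> : p ^+ d - x ^+ d *: q ^+ d = (p - x *: q) *
    \sum_(i < d) p ^+ (d.-1 - i) * (x *: q) ^+ i by rewrite -exprZn subrXX.
apply: sq_coprime; apply/Pdiv.ClosedField.coprimepP => y.
rewrite /root hornerD hornerN hornerZ subr_eq0 => /eqP E.
have q0 : q.[y] != 0.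
  have := coprime_nz y R.1; rewrite /nz E.
  by apply: contraTneq => ->; rewrite mulr0 eqxx.
rewrite horner_sum (eq_bigr (fun=> (x * q.[y]) ^+ d.-1)).
  rewrite sumr_const card_ord mulrn_eq0 negb_or -lt0n d0.
  by rewrite expf_neq0 // mulf_neq0.
move=> i _; rewrite hornerM !horner_exp hornerZ E -exprD subnK //.
by rewrite -ltnS prednK.
Qed.

Lemma full_pow_even d phi : ~~ odd d -> (0 < d)%N -> ratl phi ->
  full (fun w => powS d (phi w)) s0 /\ full (fun w => powS d (phi w)) soo.
Proof.
move=> de d0 [[p [q R]] _]; have dE := odd_double_half d; rewrite (negPf de) add0n in dE.
split; exists (p ^+ d), (q ^+ d); split; try exact: rep_pow; rewrite /fullp /lin /=.
  by rewrite scale0r subr0 scale1r; exists (p ^+ d./2); rewrite -exprM muln2 dE.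
rewrite scale0r sub0r -scaleN1r sqZ ?oppr_eq0 ?oner_eq0 // scale1r.
by exists (q ^+ d./2); rewrite -exprM muln2 dE.
Qed.

Lemma full_pow2_asc phi x : ratl phi -> full phi (Some x) -> full phi (Some (- x)) ->
  full (fun w => powS 2 (phi w)) (Some (x ^+ 2)).
Proof.
move=> [[p [q R]] _] /(full_rep R) F1 /(full_rep R) F2.
exists (p ^+ 2), (q ^+ 2); split; first exact: rep_pow.
rewrite /fullp /=.
have -> : lin (p ^+ 2) (q ^+ 2) (x ^+ 2) 1 = lin p q x 1 * lin p q (- x) 1.
  by rewrite /lin -!mul_polyC !(rmorphN, rmorphXn, rmorph1) /=; ring.
exact: sq_mul.
Qed.

(** The form [X - x] has odd degree. Infinity is left out: its form is constant, hence a square,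
    because only the affine chart is seen. *)
Lemma not_full_id x : ~ full id (Some x).
Proof.
move=> /(full_rep rep_id) [r]; rewrite /lin /= scale1r -mul_polyC mulr1 => E.
have := congr1 (fun p : {poly K} => size p) E; rewrite size_XsubC.
have [->|r0] := eqVneq r 0; first by rewrite expr0n size_poly0.
by rewrite sq_size //; lia.
Qed.

End Rational.

(** * Maps with two critical points *)

Section Bicritical.
Variable K : numClosedFieldType.
Implicit Types (u v x : K) (z t : sphere K).
Implicit Types (f g phi psi m A B M : sphere K -> sphere K).

Local Notation s0 := (s0 K).
Local Notation s1 := (s1 K).
Local Notation soo := (soo K).

(** For [d] at least 2, [B] carries the critical points to [0] and infinity, and the critical values
    are [A s0] and [A soo]. *)
Definition nf d f A B := [/\ Mob A, Mob B & forall z, f z = A (powS d (B z))].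
Definition isV A t := t = A s0 \/ t = A soo.

Lemma isV_dec A t : isV A t \/ ~ isV A t.
Proof.
rewrite /isV; have [->|/eqP n0] := eqVneq t (A s0); first by left; left.
by have [->|/eqP n1] := eqVneq t (A soo); [left; right|right; case].
Qed.

Section Fixed.
Variables (d : nat) (f A B : sphere K -> sphere K).
Hypothesis (d0 : (0 < d)%N) (F : nf d f A B).

Lemma nf_onto phi : onto phi -> onto (fun z => f (phi z)).
Proof.
move=> o w; have [MA MB E] := F; have [a <-] := Mob_surj MA w.
have [b <-] := pow_surj a d0; have [c <-] := Mob_surj MB b.
by have [e <-] := o c; exists e; rewrite E.
Qed.

Lemma nf_ratl phi : ratl phi -> ratl (fun z => f (phi z)).
Proof.
move=> R; have [MA MB E] := F.
apply: (@ratl_ext _ (fun z => A (powS d (B (phi z))))) => [z|]; first by rewrite E.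
by apply: ratl_mob MA (ratl_pow d0 (ratl_mob MB R)).
Qed.

Lemma iter_onto k : onto (iter k f).
Proof. by elim: k => [|k IH] w /=; [exists w|apply: nf_onto]. Qed.

Lemma iter_ratl k : ratl (iter k f).
Proof. by elim: k => [|k IH] /=; [apply: ratl_id|apply: nf_ratl]. Qed.

Lemma nf_isV z : isV A (f z) <-> B z = s0 \/ B z = soo.
Proof.
have [MA MB E] := F; rewrite /isV E; split=> -[].
- by move/(Mob_inj MA)/(pow_is0 d0); left.
- by move/(Mob_inj MA)/pow_isoo; right.
- by move=> ->; left; rewrite pow0.
- by move=> ->; right.
Qed.

Lemma full_desc psi z : ratl psi -> ~ isV A (f z) ->
  full (fun w => f (psi w)) (f z) -> full psi z.
Proof.
have [MA MB E] := F; move=> R /nf_isV nV Fu.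
have {}Fu : full (fun w => A (powS d (B (psi w)))) (A (powS d (B z))).
  by rewrite -E; apply: full_ext Fu => w; rewrite E.
apply/(full_mob z MB R); apply: (full_pow_desc d0).
- exact: ratl_mob.
- by move=> H; apply: nV; left.
- by move=> H; apply: nV; right.
by apply/(full_mob _ MA); first exact: ratl_pow d0 (ratl_mob MB R).
Qed.

Lemma fullV psi t : ~~ odd d -> ratl psi -> isV A t -> full (fun w => f (psi w)) t.
Proof.
have [MA MB E] := F; move=> de R H.
apply: (@full_ext _ (fun w => A (powS d (B (psi w))))) => [w|]; first by rewrite E.
have [F0 Foo] := full_pow_even de d0 (ratl_mob MB R).
have RP := ratl_pow d0 (ratl_mob MB R).
by case: H => ->; apply/(full_mob _ MA RP).
Qed.

End Fixed.

(** * Fibres over points that are not critical values *)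

Lemma unity_uniq d : (0 < d)%N -> exists rs : seq K,
  [/\ uniq rs, size rs = d & {in rs, forall w, w ^+ d = 1}].
Proof.
move=> d0; have [rs] := closed_field_poly_normal ('X^d - 1 : {poly K}).
rewrite lead_coefXnsubC // scale1r => Ers; exists rs; split.
- by rewrite -separable_prod_XsubC -Ers separable_Xn_sub_1 // pnatr_eq0 -lt0n.
- by have := size_XnsubC (1 : K) d0; rewrite Ers size_prod_XsubC => -[].
- by move=> w; rewrite -root_prod_XsubC -Ers /root !hornerE subr_eq0 => /eqP.
Qed.

Lemma nf_fiber d f A B t : (0 < d)%N -> nf d f A B -> ~ isV A t ->
  exists zs, [/\ uniq zs, size zs = d & {in zs, forall z, f z = t}].
Proof.
move=> d0 F nV; have [z0 zt] := nf_onto d0 F (fun w => ex_intro _ w erefl) t.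
have [MA MB E] := F; have [B' [MB' BB' B'B]] := Mob_inv MB.
case Ez: (B z0) => [x|]; last first.
  by case: nV; rewrite -zt; apply/(nf_isV d0 F); right.
have x0 : x != 0.
  apply/eqP => x0; case: nV; rewrite -zt; apply/(nf_isV d0 F).
  by left; rewrite Ez x0.
have [rs [urs szrs rs1]] := unity_uniq d0.
exists [seq B' (Some (w * x)) | w <- rs]; split; rewrite ?size_map //.
  rewrite map_inj_uniq // => w w' /(can_inj B'B)[].
  by apply: mulIf.
move=> _ /mapP[w /rs1 w1 ->].
by rewrite -zt !E B'B Ez /= exprMn w1 mul1r.
Qed.

Lemma full_ge4 d f A B psi t : (4 <= d)%N -> nf d f A B -> ratl psi -> onto psi ->
  full (fun w => f (psi w)) t -> isV A t.
Proof.
move=> d4 F R o Fu; have d0 : (0 < d)%N by apply: leq_trans d4.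
have [//|nV] := isV_dec A t.
have [zs [uz sz zst]] := nf_fiber d0 F nV.
have fz z : z \in zs -> full psi z.
  by move=> /zst E; apply: (full_desc d0 F R); rewrite E.
case: zs uz sz {zst} fz => [|z1 [|z2 [|z3 [|z4 zs]]]] uz sz fz; try by rewrite -sz in d4.
exfalso; apply: (@four_full _ psi z1 z2 z3 z4) => //; try by apply: fz; rewrite !inE eqxx ?orbT.
by move: uz; rewrite (cat_uniq [:: z1; z2; z3; z4]) => /andP[].
Qed.

Lemma nf2_fiber f A B (x y z : sphere K) : nf 2 f A B -> f x = f y -> f x = f z -> x <> y ->
  z = x \/ z = y.
Proof.
move=> [MA MB E]; rewrite !E => /(Mob_inj MA) + /(Mob_inj MA) + nxy.
have {}nxy : B x <> B y by move/(Mob_inj MB).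
case Ex: (B x) nxy => [u|]; case Ey: (B y) => [v|] //= nuv; case Ez: (B z) => [w|] //= [uv] [uw].
have /orP[/eqP k|/eqP k] : (u == v) || (u == - v) by rewrite -eqf_sqr uv.
  by case: nuv; rewrite k.
have /orP[/eqP l|/eqP l] : (w == u) || (w == - u) by rewrite -eqf_sqr uw.
  by left; apply: (Mob_inj MB); rewrite Ez Ex l.
by right; apply: (Mob_inj MB); rewrite Ez Ey l k opprK.
Qed.

(** Induction on [k]: both preimages of [t] turn out to be critical values, hence they are the two
    critical values. At the bottom, one of the preimages is finite, which [not_full_id] excludes. *)
Lemma full_exceptional f A B k t : nf 2 f A B -> full (iter k.+1 f) t -> ~ isV A t ->
  f (A s0) = t /\ f (A soo) = t.
Proof.
move=> F; have [MA MB E] := F; have Af : A s0 <> A soo by move/(Mob_inj MA).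
elim: k t => [|k IH] t Fu nV.
  have [[|s [|s' [|s'' zs]]] [us // _ st]] := nf_fiber (isT : 0 < 2)%N F nV.
  have fs z : z \in [:: s; s'] -> full id z.
    by move=> /st zt; apply: (full_desc (isT : 0 < 2)%N F (ratl_id K)); rewrite zt.
  have := fs s; have := fs s'; rewrite !inE !eqxx orbT => /(_ isT) + /(_ isT).
  case: s us {st fs} => [x|] us; first by move=> _ /not_full_id.
  by case: s' us => [x|] // _ /not_full_id.
have [[|s [|s' [|s'' zs]]] [us // _ st]] := nf_fiber (isT : 0 < 2)%N F nV.
have ns : s <> s' by move: us; rewrite /= inE andbT => /eqP.
have fs z : z \in [:: s; s'] -> full (iter k.+1 f) z.
  move=> /st zt; apply: (full_desc (isT : 0 < 2)%N F); rewrite ?zt //.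
  exact: (iter_ratl _ F).
have fs1 : full (iter k.+1 f) s by apply: fs; rewrite !inE eqxx.
have fs2 : full (iter k.+1 f) s' by apply: fs; rewrite !inE eqxx orbT.
have Es : f s = t by apply: st; rewrite !inE eqxx.
have Es' : f s' = t by apply: st; rewrite !inE eqxx orbT.
have fV z : isV A z -> full (iter k.+1 f) z.
  by apply: (fullV (isT : 0 < 2)%N F) => //; exact: (iter_ratl _ F).
(* If [r'] is not a critical value, then by induction [f] sends both critical values to [r']. Now
   [r] is one of them, lest four points be full, so [r' = t]. The fibre over [t] is then the pair of
   critical values, yet it contains [r']. *)
have key r r' : r <> r' -> full (iter k.+1 f) r -> full (iter k.+1 f) r' ->
    f r = t -> f r' = t -> ~ isV A r' -> False.
  move=> nr fr fr' Er Er' nVr; have [E0 Eoo] := IH _ fr' nVr.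
  have : isV A r.
    have [//|nVr'] := isV_dec A r; exfalso.
    apply: (@four_full _ (iter k.+1 f) r r' (A s0) (A soo)) => //.
    - exact: (iter_ratl _ F).
    - exact: (iter_onto _ F).
    - have [nV1 nV2 nV3 nV4] : [/\ r <> A s0, r <> A soo, r' <> A s0 & r' <> A soo].
        by split=> H; [apply: nVr'; left|apply: nVr'; right|apply: nVr; left|apply: nVr; right].
      by rewrite /= !inE !negb_or; do ![apply/andP; split]; try apply/eqP.
    - by apply: fV; left.
    - by apply: fV; right.
  move=> Vr; have rt : r' = t by case: Vr Er => -> <-; rewrite ?E0 ?Eoo.
  have Er0 : f (A s0) = f r' by rewrite E0 Er' rt.
  have [] := nf2_fiber F (etrans E0 (esym Eoo)) Er0 Af => H; apply: nVr; [by left|by right].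
have Vs : isV A s.
  by have [//|nVs] := isV_dec A s; case: (key s' s) => //; exact: nesym.
have Vs' : isV A s'.
  by have [//|nVs] := isV_dec A s'; case: (key s s').
case: Vs Vs' => Ks [] Ks'; rewrite -?Ks -?Ks' //; by case: ns; rewrite Ks Ks'.
Qed.

End Bicritical.

(** * Cancellation, and the Klein four-group quotient *)

Section Exceptional.
Variable K : numClosedFieldType.
Implicit Types (u v x : K) (z t : sphere K).
Implicit Types (f g phi psi m p q A B M : sphere K -> sphere K).

Local Notation s0 := (s0 K).
Local Notation s1 := (s1 K).
Local Notation soo := (soo K).

(** As for a quotient by a finite group of Moebius maps: two rational lifts of one map through [p]
    differ by a deck transformation. *)
Definition galois p := forall a b : sphere K -> sphere K, ratl a -> ratl b ->
  (forall z, p (a z) = p (b z)) ->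
  exists kap, [/\ Mob kap, forall z, a z = kap (b z) & forall z, p (kap z) = p z].

Lemma iter_shift p M k z : iter k.+1 (fun w => M (p w)) z =
  M (iter k (fun w => p (M w)) (p z)).
Proof. by elim: k => //= k <-. Qed.

Lemma iter_ext (p q : sphere K -> sphere K) k z :
  (forall w, p w = q w) -> iter k p z = iter k q z.
Proof. by move=> E; elim: k => //= k ->. Qed.

Lemma ratl_iter p k phi : (forall phi, ratl phi -> ratl (fun z => p (phi z))) ->
  ratl phi -> ratl (fun z => iter k p (phi z)).
Proof. by move=> H R; elim: k => //= k IH; apply: H. Qed.

(** Cancelling the outer [p] in [p^k = (p M)^k] gives a deck transformation [kap], and [M' = kap M]
    satisfies [p^(k-1) = M' (p M)^(k-1)]. The last two conclusions follow by regrouping, since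
    [p M' = p M]. *)
Lemma share p M k : (forall phi, ratl phi -> ratl (fun z => p (phi z))) ->
  galois p -> Mob M -> (0 < k)%N ->
  (forall z, iter k p z = iter k (fun w => p (M w)) z) ->
  exists M', [/\ Mob M', forall z, p (M' z) = p (M z),
    forall z, iter k (fun w => M' (p w)) z = iter k p z
  & forall z, M' (iter k p z) = iter k p (M' z)].
Proof.
move=> Rp G MM; case: k => // k _ E.
have RpM phi : ratl phi -> ratl (fun z => p (M (phi z))).
  by move=> R; apply: Rp (ratl_mob MM R).
have R1 := ratl_iter k Rp (ratl_id K).
have R2 := ratl_mob MM (@ratl_iter (fun z => p (M z)) k id RpM (ratl_id K)).
have [kap [Mk Ek pk]] := G _ _ R1 R2 E.
have pM z : p (kap (M z)) = p (M z) by rewrite pk.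
have Ei n z : iter n (fun w => p (kap (M w))) z = iter n (fun w => p (M w)) z.
  by apply: iter_ext.
have S z : iter k.+1 (fun w => kap (M (p w))) z = iter k.+1 p z.
  by rewrite (iter_shift p (fun w => kap (M w))) Ei -Ek iterSr.
exists (fun z => kap (M z)); split=> //; first exact: Mob_comp.
move=> z; rewrite E -Ei -[RHS]S [RHS]iterSr.
by rewrite iterSr -(iter_shift p (fun w => kap (M w))) iterSr.
Qed.

Lemma galois_pow d : (0 < d)%N -> galois (powS d).
Proof.
move=> d0 a b Ra Rb H; have [w w1 E] := pow_eq d0 Ra Rb H.
have w0 : w != 0.
  by apply/eqP => w0; move: w1; rewrite w0 expr0n eqn0Ngt d0 => /eqP; rewrite eq_sym oner_eq0.
exists (scal w); split=> // [|z]; first exact: Mob_scal.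
rewrite pow_scal // w1; case: (powS d z) => [x|]; last exact: scaloo.
by rewrite scal_some mul1r.
Qed.

Lemma galois_mob p q A B : Mob A -> Mob B -> galois q ->
  (forall z, p z = A (q (B z))) -> galois p.
Proof.
move=> MA MB G E a b Ra Rb H; have [B' [MB' BB' B'B]] := Mob_inv MB.
have [|kap [Mk Ek pk]] := G _ _ (ratl_mob MB Ra) (ratl_mob MB Rb).
  by move=> z; apply: (Mob_inj MA); rewrite -!E.
exists (fun z => B' (kap (B z))); split.
- exact: Mob_comp MB' (Mob_comp Mk MB).
- by move=> z; rewrite -Ek BB'.
- by move=> z; rewrite !E B'B pk.
Qed.

Lemma galois_nf d f A B : (0 < d)%N -> nf d f A B -> galois f.
Proof. by move=> d0 [MA MB E]; apply: galois_mob E => //; apply: galois_pow. Qed.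

(** * The Klein four-group quotient and its symmetries *)

Definition cay := @mob K (-1) 1 1 1.

Lemma two_neq0 : (2 : K) != 0.
Proof. by rewrite pnatr_eq0. Qed.

Lemma cay_pt u v : nz u v -> cay (pt u v) = pt (v - u) (u + v).
Proof. by move=> H; rewrite /cay mob_pt //; congr pt; ring. Qed.

Lemma cay_det : (-1) * 1 - 1 * 1 != 0 :> K.
Proof. by have := two_neq0; rewrite -oppr_eq0; congr (_ != 0); ring. Qed.

Lemma Mob_cay : Mob cay.
Proof. exact: Mob_mob cay_det. Qed.

Lemma nz_cay u v : nz u v -> nz (v - u) (u + v).
Proof. by move/(nz_lin cay_det); rewrite !mul1r mulN1r [- u + v]addrC. Qed.

(* The quotient of the sphere by the Klein four-group [z, -z, 1/z, -1/z]; its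
   critical values are [0], [1] and infinity. *)
Definition klein z := powS 2 (cay (powS 2 z)).

Lemma klein_pt u v : nz u v ->
  klein (pt u v) = pt ((v ^+ 2 - u ^+ 2) ^+ 2) ((u ^+ 2 + v ^+ 2) ^+ 2).
Proof.
move=> H; rewrite /klein pow_pt // cay_pt ?nz_pow // pow_pt //.
by apply: nz_cay; apply: nz_pow.
Qed.

Lemma nz_klein u v : nz u v -> nz ((v ^+ 2 - u ^+ 2) ^+ 2) ((u ^+ 2 + v ^+ 2) ^+ 2).
Proof. by move=> H; apply/nz_pow/nz_cay/nz_pow. Qed.

Definition lifts s := exists2 N, Mob N & forall z, s (klein z) = klein (N z).

Lemma lifts_sinv : lifts (@sinv K).
Proof.
have [i i2] := sqrtK (-1 : K); have i0 : i != 0.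
  by apply/eqP => i0; move: i2; rewrite i0 expr0n => /eqP; rewrite eq_sym oppr_eq0 oner_eq0.
(* As [i^2 = -1], scaling by [i] exchanges [v^2 - u^2] and [u^2 + v^2]. *)
exists (scal i); first exact: Mob_scal.
move=> z; rewrite -[z]pt_h; have H := nz_h z; move: (hn z) (hd z) H => u v H.
have H' : nz (i * u) v by move: H; rewrite /nz mulf_eq0 negb_or i0.
rewrite scal_pt // !klein_pt // sinv_pt ?nz_klein // exprMn i2.
by congr pt; ring.
Qed.

Definition one_sub := @mob K (-1) 1 0 1.

Lemma one_sub_det : (-1) * 1 - 1 * 0 != 0 :> K.
Proof. by rewrite mulr0 subr0 mulr1 oppr_eq0 oner_eq0. Qed.

Lemma Mob_one_sub : Mob one_sub.
Proof. exact: Mob_mob one_sub_det. Qed.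

Lemma one_subK z : one_sub (one_sub z) = z.
Proof.
rewrite -[z]pt_h /one_sub !mob_pt ?nz_h //; last by apply: nz_lin one_sub_det (nz_h z).
by congr pt; ring.
Qed.

Lemma lifts_one_sub : lifts one_sub.
Proof.
(* Here [(u^2 + v^2)^2 - (v^2 - u^2)^2 = 4 u^2 v^2], and [cay] turns [v^2 - u^2] into [4 u v] and
   [u^2 + v^2] into twice itself. *)
exists cay; first exact: Mob_cay.
move=> z; rewrite -[z]pt_h; have H := nz_h z; move: (hn z) (hd z) H => u v H.
rewrite cay_pt // !klein_pt ?nz_cay // /one_sub mob_pt ?nz_klein //.
rewrite -(ptZ _ _ (expf_neq0 2 two_neq0)); congr pt; ring.
Qed.

Lemma lifts_comp s s' : lifts s -> lifts s' -> lifts (fun z => s (s' z)).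
Proof.
move=> [N MN E] [N' MN' E']; exists (fun z => N (N' z)); first exact: Mob_comp.
by move=> z; rewrite E' E.
Qed.

Lemma lifts_ext s s' : (forall z, s' z = s z) -> lifts s -> lifts s'.
Proof. by move=> E [N MN H]; exists N => // z; rewrite E. Qed.

Definition marked z := [\/ z = s0, z = s1 | z = soo].

Lemma one_sub0 : one_sub s0 = s1.
Proof. by rewrite /one_sub /mob /pt /= !(mul1r, mulr1, mul0r, mulr0, addr0, add0r) oner_eq0 invr1. Qed.
Lemma one_sub1 : one_sub s1 = s0.
Proof. by rewrite -one_sub0 one_subK. Qed.
Lemma one_suboo : one_sub soo = soo.
Proof. by rewrite /one_sub /mob /pt /= !(mul1r, mulr1, mul0r, mulr0, addr0, add0r) eqxx. Qed.
Lemma sinv1 : sinv s1 = s1.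
Proof. by rewrite /sinv /mob /pt /= !(mul1r, mulr1, mul0r, mulr0, addr0, add0r) oner_eq0 invr1. Qed.

Lemma marked_one_sub z : marked z -> marked (one_sub z).
Proof.
by case=> ->; rewrite ?one_sub0 ?one_sub1 ?one_suboo;
  [constructor 2|constructor 1|constructor 3].
Qed.

Lemma marked_sinv z : marked z -> marked (sinv z).
Proof.
by case=> ->; rewrite ?sinv0 ?sinv1 ?sinvoo;
  [constructor 3|constructor 2|constructor 1].
Qed.

(* [sinv] and [one_sub] generate the group of permutations of [0, 1, oo]. *)
Lemma klein_lifts s : Mob s -> marked (s s0) -> marked (s s1) -> marked (s soo) ->
  lifts s.
Proof.
have H3 : forall s, Mob s -> s soo = soo -> s s0 = s0 -> marked (s s1) -> lifts s.
  move=> {}s Ms soo' s0' [] E.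
  - by have := Mob_inj Ms (etrans E (esym s0')) => /esym/s01.
  - exists id; first exact: Mob_id.
    by move=> z; rewrite (@Mob_fix3 _ s s0 s1 soo) //; exact: s01.
  - by have := Mob_inj Ms (etrans E (esym soo')).
have conj1 s' : lifts (fun z => one_sub (s' z)) -> lifts s'.
  by move=> L; apply: lifts_ext (lifts_comp lifts_one_sub L) => z; rewrite one_subK.
have conj2 s' : lifts (fun z => sinv (s' z)) -> lifts s'.
  by move=> L; apply: lifts_ext (lifts_comp lifts_sinv L) => z; rewrite sinvK.
have H2 : forall s, Mob s -> s soo = soo -> marked (s s0) -> marked (s s1) -> lifts s.
  move=> {}s Ms soo' [] E m1; first exact: H3.
    apply: conj1; apply: H3; rewrite ?soo' ?E ?one_suboo ?one_sub1 //.
      exact: Mob_comp Mob_one_sub Ms.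
    exact: marked_one_sub.
  by have := Mob_inj Ms (etrans E (esym soo')).
have H1 : forall s, Mob s -> s soo = s0 -> marked (s s0) -> marked (s s1) -> lifts s.
  move=> {}s Ms soo' m0 m1; apply: conj2; apply: H2; rewrite ?soo' ?sinv0 //.
  - exact: Mob_comp (Mob_sinv K) Ms.
  - exact: marked_sinv.
  - exact: marked_sinv.
move=> Ms m0 m1 [] E; [exact: H1| |exact: H2].
apply: conj1; apply: H1; rewrite ?E ?one_sub1 //.
- exact: Mob_comp Mob_one_sub Ms.
- exact: marked_one_sub.
- exact: marked_one_sub.
Qed.

(** The two squarings are cancelled in turn. The outer one leaves a sign, and [-1] is absorbed by
    replacing [b] with [1 / b], because [cay (1 / z) = - cay z]. *)
Lemma galois_klein : galois klein.
Proof.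
move=> a b Ra Rb H; have P2 : (0 < 2)%N by [].
have Rca := ratl_mob Mob_cay (ratl_pow P2 Ra).
have Rcb := ratl_mob Mob_cay (ratl_pow P2 Rb).
have [w /eqP w2 E] := pow_eq P2 Rca Rcb H.
have case1 b' : ratl b' -> (forall z, powS 2 (a z) = powS 2 (b' z)) ->
    exists kap, [/\ Mob kap, forall z, a z = kap (b' z) & forall z, klein (kap z) = klein z].
  move=> Rb' H'; have [kap [Mk Ek pk]] := galois_pow P2 Ra Rb' H'.
  by exists kap; split=> // z; rewrite /klein pk.
have cay_inv z : cay (sinv z) = scal (-1) (cay z).
  rewrite -[z]pt_h; have Hz := nz_h z; move: (hn z) (hd z) Hz => u v Hz.
  rewrite sinv_pt // !cay_pt // ?scal_pt ?nz_cay //; last by move: Hz; rewrite /nz orbC.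
  by congr pt; ring.
move: w2; rewrite sqrf_eq1 => /orP[] /eqP w1; rewrite w1 in E.
  apply: case1 => // z; apply: (Mob_inj Mob_cay); rewrite E.
  by case: (cay _) => [x|]; rewrite ?scaloo // scal_some mul1r.
have [|kap [Mk Ek pk]] := case1 _ (ratl_mob (Mob_sinv K) Rb).
  by move=> z; apply: (Mob_inj Mob_cay); rewrite E pow_sinv // cay_inv.
exists (fun z => kap (sinv z)); split=> //; first exact: Mob_comp Mk (Mob_sinv K).
move=> z; rewrite pk /klein pow_sinv // cay_inv pow_scal // sqrrN expr1n.
by case: (powS 2 _) => [x|]; rewrite ?scaloo // scal_some mul1r.
Qed.

End Exceptional.

(** * The exceptional quadratic case *)

Section CriticalValues.
Variable K : numClosedFieldType.
Implicit Types (z t v x : sphere K).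
Implicit Types (f g phi psi m p q A B M L : sphere K -> sphere K).

Local Notation s0 := (s0 K).
Local Notation s1 := (s1 K).
Local Notation soo := (soo K).
Local Notation sm1 := (Some (-1) : sphere K).

(* Then [f v1 = f v2 = t], where [v1] and [v2] are the critical values of [f]. *)
Definition exn f A B (v1 v2 t : sphere K) :=
  [/\ nf 2 f A B, [/\ A s0 = v1, A soo = v2 & A s1 = t], B v1 = s1 & B v2 = sm1].

Lemma nf_swap d f A B : (0 < d)%N -> nf d f A B ->
  nf d f (fun z => A (sinv z)) (fun z => sinv (B z)).
Proof.
move=> d0 [MA MB E]; split.
- exact: Mob_comp MA (Mob_sinv K).
- exact: Mob_comp (Mob_sinv K) MB.
- by move=> z; rewrite pow_sinv // sinvK.
Qed.

Lemma exn_normal f A B t : nf 2 f A B -> f (A s0) = t -> f (A soo) = t ->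
  ~ isV A t -> exists A' B', exn f A' B' (A s0) (A soo) t.
Proof.
move=> F E0 Eoo nV; have [MA MB E] := F; have P2 : (0 < 2)%N by [].
case Eb: (B (A s0)) => [b|]; last first.
  by case: nV; rewrite -E0; apply/(nf_isV P2 F); right.
have b0 : b != 0.
  by apply/eqP => b0; case: nV; rewrite -E0; apply/(nf_isV P2 F); left; rewrite Eb b0.
exists (fun z => A (scal (b ^+ 2) z)), (fun z => scal b^-1 (B z)).
have F' : nf 2 f (fun z => A (scal (b ^+ 2) z)) (fun z => scal b^-1 (B z)).
  split.
  - by apply: Mob_comp MA (Mob_scal _); rewrite expf_neq0.
  - by apply: Mob_comp (Mob_scal _) MB; rewrite invr_eq0.
  move=> z; rewrite pow_scal // E; congr A.
  case: (powS 2 (B z)) => [x|]; rewrite ?scaloo // !scal_some mulrA -exprMn divff //.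
  by rewrite expr1n mul1r.
have Eb1 : scal b^-1 (B (A s0)) = s1 by rewrite Eb scal_some mulVf.
split=> //.
  split; rewrite ?scal0 ?scaloo //.
  by rewrite -E0 E Eb scal_some mulr1.
have : powS 2 (scal b^-1 (B (A soo))) = s1.
  have [MA' MB' E'] := F'; apply: (Mob_inj MA'); rewrite -E' Eoo -E0 E' Eb1.
  by rewrite /s1 /= expr1n.
case Ex: (scal b^-1 (B (A soo))) => [x|] // [] /eqP; rewrite sqrf_eq1 => /orP[] /eqP Ex1.
  have [_ MB' _] := F'; have := Mob_inj MB' (etrans Ex (etrans (congr1 Some Ex1) (esym Eb1))).
  by move/(Mob_inj MA).
by rewrite Ex1.
Qed.

Lemma cay0 : cay s0 = s1.
Proof. by rewrite -[s0]pt01 cay_pt ?subr0 ?add0r /pt ?oner_eq0 ?divr1 // /nz oner_eq0 orbT. Qed.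

Lemma cayoo : cay soo = sm1.
Proof. by rewrite -[soo]pt10 cay_pt ?sub0r ?addr0 /pt ?oner_eq0 ?divr1 // /nz oner_eq0. Qed.

(** Both [B A] and [cay] send [0] to [1] and infinity to [-1], so they agree up to a scaling. *)
Lemma exn_cay f A B v1 v2 t : exn f A B v1 v2 t ->
  exists2 w : K, w != 0 & forall z, B (A z) = cay (scal w z).
Proof.
move=> [[MA MB E] [A0 Aoo _] B1 B2]; have [c [Mc cK Kc]] := Mob_inv (Mob_cay K).
have MM : Mob (fun z => c (B (A z))) by apply: Mob_comp Mc (Mob_comp MB MA).
have [||w w0 H] := Mob_fix0oo MM.
- by rewrite A0 B1 -cay0 cK.
- by rewrite Aoo B2 -cayoo cK.
by exists w => // z; rewrite -H Kc.
Qed.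

(** Between [A] and [B] the composite [f f] is the square of [cay (w z^2)]; a square root [s] of [w]
    turns [w z^2] into [(s z)^2]. *)
Lemma exn_klein f A B v1 v2 t : exn f A B v1 v2 t ->
  exists2 B2, Mob B2 & forall z, f (f z) = A (klein (B2 z)).
Proof.
move=> X; have [w w0 H] := exn_cay X; have [[MA MB E] _ _ _] := X.
have [s s2] := sqrtK w; have sn0 : s != 0 by apply: contraNneq w0 => s0'; rewrite -s2 s0' expr0n.
exists (fun z => scal s (B z)); first exact: Mob_comp (Mob_scal sn0) MB.
by move=> z; rewrite !E H /klein pow_scal // s2.
Qed.

(* With the normalisation [A = id], the points [v1], [v2], [t], [y] are [0], infinity, [1] and
   [Y]; the orbit [v1, v2 -> t -> y -> y] leaves only the parameters below. *)
Lemma exn_param f A B v1 v2 t Y : exn f A B v1 v2 t ->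
  f t = A (Some Y) -> f (A (Some Y)) = A (Some Y) -> t <> A (Some Y) ->
  (Y + 1) * ((1 - Y) ^+ 2 - 4 * Y) = 0.
Proof.
move=> X; have [w w0 H] := exn_cay X; have [[MA MB E] [A0 Aoo A1] _ _] := X.
rewrite -A1 !E => /(Mob_inj MA) Et /(Mob_inj MA) Ey ne.
case Et': (B (A s1)) Et => [a|] //= [EY].
case Ey': (B (A (Some Y))) Ey => [b|] //= [EY'].
(* [t] and the fixed point have the same image under [f], so [B] sends them to opposite square roots
   of [Y]. *)
have ab : b = - a.
  have /orP[/eqP ab|/eqP //] : (b == a) || (b == - a) by rewrite -eqf_sqr EY EY'.
  by case: ne; apply: (Mob_inj MB); rewrite Et' Ey' ab.
have nz1 (x : K) : nz x 1 by rewrite /nz oner_eq0 orbT.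
have cayE (x y : K) : cay (Some x) = Some y -> 1 - x = y * (x + 1).
  rewrite -[Some x]pt_h -[Some y]pt_h cay_pt ?nz_h //= => /pt_eq.
  by rewrite mulr1; apply; [exact: nz_cay (nz1 x)|exact: nz1].
move: Et' Ey'; rewrite !H ab /s1 !scal_some mulr1 => /cayE e1 /cayE e2.
have k1 : w * (1 + a) = 1 - a.
  by apply/eqP; rewrite -subr_eq0; apply/eqP; transitivity (a * (w + 1) - (1 - w)); [ring|rewrite e1 subrr].
have k2 : 1 + a = w * Y * (1 - a).
  by apply/eqP; rewrite -subr_eq0; apply/eqP;
     transitivity ((1 - w * Y) - (- a * (w * Y + 1))); [ring|rewrite e2 subrr].
have k3 : (1 + a) ^+ 2 = Y * (1 - a) ^+ 2.
  transitivity (w * (1 + a) * Y * (1 - a)); last by rewrite k1; ring.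
  by rewrite expr2 {1}k2; ring.
(* As [a^2 = Y], the relation [k3] reads [(1 + Y) (1 - Y + 2 a) = 0]; multiplying by the conjugate
   factor eliminates [a]. *)
transitivity ((1 - 2 * a - Y) * ((1 + a) ^+ 2 - Y * (1 - a) ^+ 2)).
  by rewrite -EY; ring.
by rewrite k3 subrr mulr0.
Qed.

Lemma iter_pair f k z : iter k (fun z => f (f z)) z = iter k f (iter k f z).
Proof. by elim: k => //= k ->; rewrite -iterS iterSr -iterS -iterSr. Qed.

Lemma iter_pair_comm f k z :
  f (iter k (fun z => f (f z)) z) = iter k (fun z => f (f z)) (f z).
Proof. by elim: k => //= k ->. Qed.

(** * Postcritical orbits of two exceptional maps *)

Section Half.
Variables (f g A B A' B' : sphere K -> sphere K) (v1 v2 t : sphere K) (k : nat).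
Hypotheses (X : exn f A B v1 v2 t) (X' : exn g A' B' v1 t v2).
Let p z := f (f z).
Let q z := g (g z).
Hypothesis Epq : forall z, iter k.+1 p z = iter k.+1 q z.
Let F := iter k.+1 p.

Let P2 : (0 < 2)%N. Proof. by []. Qed.
Let nff : nf 2 f A B. Proof. by case: X. Qed.
Let MA : Mob A. Proof. by case: nff. Qed.
Let MB : Mob B. Proof. by case: nff. Qed.
Let fE z : f z = A (powS 2 (B z)). Proof. by case: nff. Qed.

Let v12 : v1 <> v2.
Proof. by case: X => _ [<- <- _] _ _ /(Mob_inj MA). Qed.
Let v1t : v1 <> t.
Proof. by case: X => _ [<- _ <-] _ _ /(Mob_inj MA)/s01. Qed.
Let v2t : v2 <> t.
Proof. by case: X => _ [_ <- <-] _ _ /(Mob_inj MA). Qed.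

Let fv1 : f v1 = t.
Proof. by case: X => _ [_ _ <-] B1 _; rewrite fE B1 /s1 /= expr1n. Qed.
Let fv2 : f v2 = t.
Proof. by case: X => _ [_ _ <-] _ B2; rewrite fE B2 /= sqrrN expr1n. Qed.
Let gv1 : g v1 = v2.
Proof. by case: X' => [[_ _ E] [_ _ <-] B1 _]; rewrite E B1 /s1 /= expr1n. Qed.
Let gt : g t = v2.
Proof. by case: X' => [[_ _ E] [_ _ <-] _ B2]; rewrite E B2 /= sqrrN expr1n. Qed.

Let inT z := [\/ z = v1, z = v2 | z = t].

Let pr phi : ratl phi -> ratl (fun z => p (phi z)).
Proof. by move=> R; apply: (nf_ratl P2 nff); apply: (nf_ratl P2 nff). Qed.

Let isVf z : isV A z <-> z = v1 \/ z = v2.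
Proof. by case: X => _ [A0 Aoo _] _ _; rewrite /isV A0 Aoo. Qed.

(** Over [t] the fibre of [p] consists of the fibres of [f] over [v1] and [v2]; their forms are
    squares and multiply to a square. *)
Let full_p psi z : ratl psi -> inT z -> full (fun w => p (psi w)) z.
Proof.
move=> R Tz; have Rf := nf_ratl P2 nff R.
have fv x : isV A x -> full (fun w => f (f (psi w))) x by apply: (fullV P2 nff).
case: Tz => ->; [by apply/fv/isVf; left|by apply/fv/isVf; right|].
have fv' x : isV A x -> full (fun w => B (f (psi w))) (B x).
  by move=> Vx; apply/(full_mob _ MB Rf); apply: (fullV P2 nff).
have [_ [_ _ A1] B1 B2] := X.
have F1 : full (fun w => B (f (psi w))) (Some 1).
  by have := fv' v1; rewrite B1; apply; apply/isVf; left.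
have F2 : full (fun w => B (f (psi w))) (Some (-1)).
  by have := fv' v2; rewrite B2; apply; apply/isVf; right.
have := full_pow2_asc (ratl_mob MB Rf) F1 F2; rewrite expr1n => F3.
apply: (@full_ext _ (fun w => A (powS 2 (B (f (psi w)))))); first by move=> w; rewrite /p fE.
by rewrite -A1; apply/(full_mob _ MA); first exact: ratl_pow P2 (ratl_mob MB Rf).
Qed.

Let full_F z : full F z -> inT z.
Proof.
move=> Fz; have [->|/eqP n1] := eqVneq z v1; first by constructor 1.
have [->|/eqP n2] := eqVneq z v2; first by constructor 2.
have [->|/eqP n3] := eqVneq z t; first by constructor 3.
have R : ratl (iter k p) := @ratl_iter _ p k id pr (ratl_id K).
have Tf x : inT x -> full F x by apply: full_p.
exfalso; apply: (@four_full _ F v1 v2 t z) => //.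
- exact: pr.
- move=> w; have po : onto p.
    move=> x; have := nf_onto P2 nff (nf_onto P2 nff (fun w => ex_intro _ w erefl)).
    exact.
  rewrite /F; elim: k.+1 w => [|j IH] w /=; first by exists w.
  by have [a <-] := po w; have [b <-] := IH a; exists b.
- rewrite /= !inE !negb_or; do ![apply/andP; split] => //; apply/eqP => //; exact: nesym.
- by apply: Tf; constructor 1.
- by apply: Tf; constructor 2.
- by apply: Tf; constructor 3.
Qed.

Let shared L := Mob L /\ forall z, iter k.+1 (fun w => L (p w)) z = F z.

(** The points of [inT] are exactly the full values of [F]. Since [L p] has the same iterate [F],
    the [L]-image of a full value of [p] is full for [F]. *)
Let sharedT L z : shared L -> inT z -> inT (L z).
Proof.
move=> [ML E] Tz; apply: full_F.
apply: (@full_ext _ (iter k.+1 (fun w => L (p w)))) => [w|]; first by rewrite E.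
have RLp phi : ratl phi -> ratl (fun w => L (p (phi w))).
  by move=> R; apply: ratl_mob ML (pr R).
have R : ratl (iter k (fun w => L (p w))) := @ratl_iter _ _ k id RLp (ratl_id K).
by apply/(full_mob _ ML (pr R)); apply: full_p.
Qed.

Let pv1 : p v1 = f t. Proof. by rewrite /p fv1. Qed.
Let pv2 : p v2 = f t. Proof. by rewrite /p fv2. Qed.

Let y := F v1.

Let Fv2 : F v2 = y. Proof. by rewrite /y /F !iterSr pv1 pv2. Qed.
(** Here the other map enters: [q] takes the same value at [t] and at [v1]. *)
Let Ft : F t = y. Proof. by rewrite /y /F !Epq !iterSr /q gt gv1. Qed.
Let FT z : inT z -> F z = y. Proof. by case=> ->. Qed.
Let fy : f y = y.
Proof. by rewrite {1}/y /F iter_pair_comm fv1; exact: Ft. Qed.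

Let galois_p : galois p.
Proof.
have [B2 MB2 E] := exn_klein X.
exact: galois_mob MA MB2 (@galois_klein K) E.
Qed.

(** [L] permutes the three critical values of [p], so it lifts through [p] by [klein_lifts]. By
    [share] the lift can be chosen shared and commuting with [F], so it fixes [y], the value of [F]
    on [inT]. *)
Let lift_shared L : shared L ->
  exists L', [/\ shared L', forall z, L (p z) = p (L' z) & L' y = y].
Proof.
move=> SL; have [ML E] := SL; have [B2 MB2 Ep] := exn_klein X.
have [B2' [MB2' BB' B'B]] := Mob_inv MB2; have [A2 [MA2 AA' A'A]] := Mob_inv MA.
have [_ [A0 Aoo A1] _ _] := X.
have Tm z : inT (A z) -> marked z.
  rewrite /inT -A0 -Aoo -A1 => -[] /(Mob_inj MA) ->;
  by [constructor 1|constructor 3|constructor 2].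
have [||||N MN EN] := @klein_lifts _ (fun z => A2 (L (A z))).
- exact: Mob_comp MA2 (Mob_comp ML MA).
- by apply: Tm; rewrite A'A A0; apply: sharedT => //; constructor 1.
- by apply: Tm; rewrite A'A A1; apply: sharedT => //; constructor 3.
- by apply: Tm; rewrite A'A Aoo; apply: sharedT => //; constructor 2.
have E' z : L (p z) = p (B2' (N (B2 z))).
  by rewrite /p !Ep B'B -EN A'A.
have [|||L' [ML' H1 H2 H3]] := @share _ p (fun z => B2' (N (B2 z))) k.+1 pr galois_p.
- exact: Mob_comp MB2' (Mob_comp MN MB2).
- by [].
- move=> z; rewrite -[LHS]E; apply: iter_ext => w; exact: E'.
have SL' : shared L' by split.
exists L'; split=> //; first by move=> z; rewrite E' H1.
by rewrite /y -[F]/(iter k.+1 p) H3; apply: FT; apply: sharedT => //; constructor 1.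
Qed.

Lemma exn_postcritical : f t = y /\ f y = y.
Proof.
split=> //; have [//|/eqP x12] := eqVneq (f t) (f (f t)).
  by move=> x12; rewrite /y /F iterSr pv1 iter_fix // /p -!x12.
(* Now [p] takes one value at [v1] and [v2] and another at [t]. The contradiction comes from a
   Moebius map [L] with [q = p L], shown to be the identity although it moves [v2]. *)
exfalso; have pt2 : p t = f (f t) by [].
have px z : inT z -> p z = f t -> z = v1 \/ z = v2.
  by case=> ->; [left|right|move=> E; case: x12; exact: esym E].
have [B2 MB2 Ep] := exn_klein X; have [B2' [MB2' BB' B'B]] := Mob_inv MB2.
have [B3 MB3 Eq] := exn_klein X'; have [A2 [MA2 AA' A'A]] := Mob_inv MA.
have [_ [A0 Aoo A1] _ _] := X; have [[MA' _ _] [A'0 A'oo A'1] _ _] := X'.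
have [||||N MN EN] := @klein_lifts _ (fun z => A2 (A' z)).
- exact: Mob_comp MA2 MA'.
- by rewrite A'0 -A0 AA'; constructor 1.
- by rewrite A'1 -Aoo AA'; constructor 3.
- by rewrite A'oo -A1 AA'; constructor 2.
have qE z : q z = p (B2' (N (B3 z))).
  by rewrite /p /q Ep Eq B'B -EN A'A.
have [|||L [ML H1 H2 H3]] := @share _ p (fun z => B2' (N (B3 z))) k.+1 pr galois_p.
- exact: Mob_comp MB2' (Mob_comp MN MB3).
- by [].
- by move=> z; rewrite Epq; apply: iter_ext.
have SL : shared L by split.
have Ly : L y = y by rewrite /y -[F]/(iter k.+1 p) H3; apply: FT; apply: sharedT => //; constructor 1.
have T1 : inT v1 by constructor 1.
have T2 : inT v2 by constructor 2.
have T3 : inT t by constructor 3.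
(* A lift of [M] maps at least one of [v1], [v2] into that pair, and [p] sends the whole pair to
   [f t]. *)
have fixx1 M : shared M -> M (f t) = f t.
  move=> SM; have [M' [[MM' EM'] MpE _]] := lift_shared SM.
  have := sharedT (conj MM' EM') T1; have := sharedT (conj MM' EM') T2.
  have e1 := MpE v1; have e2 := MpE v2; rewrite pv1 in e1; rewrite pv2 in e2.
  case=> E2; first by rewrite e2 E2.
    by rewrite e2 E2.
  case=> E1; first by rewrite e1 E1.
    by rewrite e1 E1.
  by case: v12; apply: (Mob_inj MM'); rewrite E1 E2.
(* [p L = q] takes the same value at [v1] and [t], while within the triple [p] identifies only [v1]
   and [v2]. *)
have Lv2 : L v2 = t.
  have pLE : p (L v1) = p (L t) by rewrite !H1 -!qE /q gv1 gt.
  have n1 : L v1 <> L v2 by move/(Mob_inj ML).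
  have n2 : L v1 <> L t by move/(Mob_inj ML).
  have n3 : L v2 <> L t by move/(Mob_inj ML).
  have := sharedT SL T1; have := sharedT SL T2; have := sharedT SL T3.
  move: pLE n1 n2 n3; move: (L v1) (L v2) (L t) => a b c.
  move=> pLE n1 n2 n3 [] Ec [] Eb [] Ea; rewrite ?Ea ?Eb ?Ec // in pLE n1 n2 n3 *.
  - by case: x12; rewrite -pt2 pLE pv1.
  - by case: x12; rewrite -pt2 pLE pv2.
  - by case: x12; rewrite -pt2 -pLE pv2.
  - by case: x12; rewrite -pt2 -pLE pv1.
have [L' [SL' LpE L'y]] := lift_shared SL; have [ML' _] := SL'.
have Lx1 := fixx1 _ SL; have L'x1 := fixx1 _ SL'.
have L'V v : v = v1 \/ v = v2 -> L' v = v1 \/ L' v = v2.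
  move=> Vv; have Tv : inT v by case: Vv => ->.
  apply: px; first exact: sharedT SL' Tv.
  by rewrite -LpE; case: Vv => ->; rewrite ?pv1 ?pv2.
have L't : L' t = t.
  case: (sharedT SL' T3) => // E.
    have [|] := L'V v1 (or_introl erefl) => E1.
      by have := Mob_inj ML' (etrans E1 (esym E)).
    have [|] := L'V v2 (or_intror erefl) => E2.
      by have := Mob_inj ML' (etrans E2 (esym E)).
    by have := Mob_inj ML' (etrans E1 (esym E2)).
  have [|] := L'V v1 (or_introl erefl) => E1; last first.
    by have := Mob_inj ML' (etrans E1 (esym E)).
  have [|] := L'V v2 (or_intror erefl) => E2; last first.
    by have := Mob_inj ML' (etrans E2 (esym E)).
  by have := Mob_inj ML' (etrans E1 (esym E2)).
have x1t : f t <> t.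
  by move=> E; have [] := nf2_fiber nff (etrans fv1 (esym fv2)) (etrans fv1 (esym E)) v12 => /esym.
have yx1 : f t <> y by move=> E; apply: x12; rewrite E fy.
have yt : t <> y by move=> E; apply: x1t; rewrite E fy.
(* [L'] fixes the distinct points [t], [f t] and [y], so it is the identity. Hence [L p = p], and
   [L] is the identity because [p] is onto. *)
have L'1 := Mob_fix3 ML' (nesym x1t) yt yx1 L't L'x1 L'y.
have po w : exists z, p z = w.
  exact: (nf_onto P2 nff (nf_onto P2 nff (fun w => ex_intro _ w erefl))).
have [z2 Ez2] := po v2.
by apply: v2t; rewrite -Lv2 -[in RHS]Ez2 LpE L'1.
Qed.

End Half.

Lemma exn_absurd f g A B A' B' v1 v2 t k : exn f A B v1 v2 t -> exn g A' B' v1 t v2 ->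
  (0 < k)%N -> (forall z, iter k f z = iter k g z) -> False.
Proof.
move=> X X'; case: k => // k _ E.
have Epq z : iter k.+1 (fun z => f (f z)) z = iter k.+1 (fun z => g (g z)) z.
  by rewrite !iter_pair !E.
have [ft fy] := exn_postcritical X X' Epq.
have [gv gy] := exn_postcritical X' X (fun z => esym (Epq z)).
move: gv gy ft fy; rewrite -Epq; set y := iter _ _ v1 => gv gy ft fy.
have [[MA MB fE] [A0 Aoo A1] B1 B2] := X; have [[MA' MB' gE] [A'0 A'oo A'1] B'1 B'2] := X'.
have v12 : v1 <> v2 by rewrite -A0 -Aoo => /(Mob_inj MA).
have fv1 : f v1 = t by rewrite fE B1 /s1 /= expr1n.
have fv2 : f v2 = t by rewrite fE B2 /= sqrrN expr1n.
have gv1 : g v1 = v2 by rewrite gE B'1 /s1 /= expr1n.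
have gt : g t = v2 by rewrite gE B'2 /= sqrrN expr1n.
have v1t : v1 <> t by rewrite -A0 -A1 => /(Mob_inj MA)/s01.
have v2t : v2 <> t by rewrite -Aoo -A1 => /(Mob_inj MA).
have ty : t <> y.
  move=> Ety; have [nff _ _ _] := X; have Et : f v1 = f t by rewrite fv1 ft.
  by have [] := nf2_fiber nff (etrans fv1 (esym fv2)) Et v12 => /esym.
have v2y : v2 <> y.
  move=> Ety; have [nfg _ _ _] := X'; have Et : g v1 = g v2 by rewrite gv1 gv.
  by have [] := nf2_fiber nfg (etrans gv1 (esym gt)) Et v1t => // /esym.
have [A2 [MA2 AA' A'A]] := Mob_inv MA; have [A3 [MA3 AA3 A3A]] := Mob_inv MA'.
case EY: (A2 y) => [Y|]; last by case: v2y; rewrite -[y]A'A EY Aoo.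
case EY': (A3 y) => [Y'|]; last by case: ty; rewrite -[y]A3A EY' A'oo.
have yE : y = A (Some Y) by rewrite -EY A'A.
have yE' : y = A' (Some Y') by rewrite -EY' A3A.
have P1 := @exn_param f A B v1 v2 t Y X; rewrite -yE in P1.
have {}P1 := P1 ft fy ty.
have P2 := @exn_param g A' B' v1 t v2 Y' X'; rewrite -yE' in P2.
have {}P2 := P2 gv gy v2y.
have nz1 (x : K) : nz x 1 by rewrite /nz oner_eq0 orbT.
have nz2 (x : K) : nz 1 x by rewrite /nz oner_eq0.
have dets : 1 * (-1) - 0 * 1 != 0 :> K.
  by have := oner_neq0 K; rewrite -oppr_eq0; congr (_ != 0); ring.
(* In the coordinates of [A'] the points [v1], [v2], [t] are [0], [1], infinity; in those of [A]
   they are [0], infinity, [1]. The change of coordinates is [z / (z - 1)]. *)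
have sE : forall z, A2 (A' z) = mob 1 0 1 (-1) z.
  apply: (@Mob_eq3 _ _ _ s0 s1 soo) => //; rewrite ?A'0 ?A'1 ?A'oo.
  - exact: Mob_comp MA2 MA'.
  - exact: Mob_mob dets.
  - exact: s01.
  - rewrite -A0 AA' -[LHS]pt01; apply/pt_eq; [exact: nz1|exact: nz_lin dets (nz_h _)|].
    by rewrite /=; ring.
  - rewrite -Aoo AA' -[LHS]pt10; apply/pt_eq; [exact: nz2|exact: nz_lin dets (nz_h _)|].
    by rewrite /=; ring.
  - rewrite -A1 AA' -[LHS]pt_h; apply/pt_eq; [exact: nz_h|exact: nz_lin dets (nz_h _)|].
    by rewrite /=; ring.
have : Some Y = mob 1 0 1 (-1) (Some Y') by rewrite -sE -yE' EY.
rewrite -[in LHS](pt_h (Some Y)) -[Some Y']pt_h mob_pt //= => /pt_eq.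
have nz3 : nz (1 * Y' + 0 * 1) (1 * Y' + -1 * 1) by apply: nz_lin.
move=> /(_ (nz1 _) nz3) R.
(* substituting [Y = Y' / (Y' - 1)] gives a second polynomial vanishing at [Y'] *)
have R1 : Y * (Y' - 1) = Y' by transitivity (Y * (1 * Y' + -1 * 1)); [ring|rewrite R; ring].
have Q : (2 * Y' - 1) * (4 * Y' ^+ 2 - 4 * Y' - 1) = 0.
  transitivity (- ((Y' - 1) ^+ 3 * ((Y + 1) * ((1 - Y) ^+ 2 - 4 * Y)))); last first.
    by rewrite P1 mulr0 oppr0.
  have -> : - ((Y' - 1) ^+ 3 * ((Y + 1) * ((1 - Y) ^+ 2 - 4 * Y))) =
    - ((Y * (Y' - 1) + (Y' - 1)) * (((Y' - 1) - Y * (Y' - 1)) ^+ 2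
       - 4 * (Y * (Y' - 1)) * (Y' - 1))) by ring.
  by rewrite R1; ring.
(* The cubics [P2] and [Q] in [Y'] have no common root: each choice of factors would make a nonzero
   integer vanish. *)
move/eqP: P2; rewrite mulf_eq0 => /orP[] /eqP P2.
  have Ym : Y' = -1 by apply/eqP; rewrite -addr_eq0 P2.
  move/eqP: Q; rewrite Ym.
  have -> : (2 * -1 - 1) * (4 * (-1) ^+ 2 - 4 * -1 - 1) = - 21%:R :> K by ring.
  by rewrite oppr_eq0 pnatr_eq0.
move/eqP: Q; rewrite mulf_eq0 => /orP[] /eqP Q.
  have : 4 * ((1 - Y') ^+ 2 - 4 * Y') = 0 by rewrite P2 mulr0.
  have -> : 4 * ((1 - Y') ^+ 2 - 4 * Y') = (2 * Y' - 1) * (2 * Y' - 11%:R) - 7%:R by ring.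
  by rewrite Q mul0r sub0r => /eqP; rewrite oppr_eq0 pnatr_eq0.
have : 4 * ((1 - Y') ^+ 2 - 4 * Y') - (4 * Y' ^+ 2 - 4 * Y' - 1) = 0 by rewrite P2 Q mulr0 subrr.
have -> : 4 * ((1 - Y') ^+ 2 - 4 * Y') - (4 * Y' ^+ 2 - 4 * Y' - 1) = - 20%:R * Y' + 5%:R by ring.
move=> H; have E4 : 4 * Y' = 1.
  apply: (@mulfI _ (5%:R : K)); first by rewrite pnatr_eq0.
  by apply/eqP; rewrite -subr_eq0 -oppr_eq0 -[X in _ == X]H; apply/eqP; ring.
have : 4 * (4 * Y' ^+ 2 - 4 * Y' - 1) = 0 by rewrite Q mulr0.
have -> : 4 * (4 * Y' ^+ 2 - 4 * Y' - 1) = (4 * Y') ^+ 2 - 4 * (4 * Y') - 4 by ring.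
rewrite E4; have -> : 1 ^+ 2 - 4 * 1 - 4 = - 7%:R :> K by ring.
by move/eqP; rewrite oppr_eq0 pnatr_eq0.
Qed.

End CriticalValues.

(** * Maps sharing an iterate *)

Section SharedIterate.
Variable K : numClosedFieldType.
Implicit Types (z t v x : sphere K).
Implicit Types (f g phi psi m p q A B M N L : sphere K -> sphere K).

Local Notation s0 := (s0 K).
Local Notation s1 := (s1 K).
Local Notation soo := (soo K).

Lemma exn_of_pair f A B a b t : nf 2 f A B -> a <> b -> isV A a -> isV A b ->
  f a = t -> f b = t -> ~ isV A t -> exists A' B', exn f A' B' a b t.
Proof.
move=> F ab Va Vb; case: Va ab => ->; case: Vb => -> ab Ea Eb nV; try by case: ab.
  exact: exn_normal F Ea Eb nV.
have := @exn_normal _ _ _ _ t (nf_swap (isT : 0 < 2)%N F); rewrite sinv0 sinvoo; apply=> //.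
by rewrite /isV sinv0 sinvoo => -[] E; apply: nV; [right|left].
Qed.

Lemma critical_values d f g A B A' B' k t : (2 <= d)%N -> ~~ odd d ->
  nf d f A B -> nf d g A' B' -> (0 < k)%N -> (forall z, iter k f z = iter k g z) ->
  isV A' t -> isV A t.
Proof.
move=> d2 de F G; case: k => // k _ E Vt; have d0 : (0 < d)%N by apply: leq_trans d2.
have full1 v : isV A' v -> full (iter k.+1 f) v.
  move=> Vv; apply: (@full_ext _ (iter k.+1 g)) => //.
  by apply: (fullV d0 G de) => //; apply: (iter_ratl d0 G).
have full2 v : isV A v -> full (iter k.+1 g) v.
  move=> Vv; apply: (@full_ext _ (iter k.+1 f)) => //.
  by apply: (fullV d0 F de) => //; apply: (iter_ratl d0 F).
have [d4|d4] := leqP 4 d.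
  by apply: (full_ge4 d4 F (iter_ratl d0 F k) (iter_onto d0 F k)); apply: full1.
have {d4} dE : d = 2 by move: d d2 de d4 {F G d0} => [|[|[|[|]]]].
subst d; have [//|nV] := isV_dec A t; exfalso.
have [f0 foo] := full_exceptional F (full1 _ Vt) nV.
have [MA _ _] := F; have [MA' _ _] := G.
have nA : A s0 <> A soo by move/(Mob_inj MA).
(* If exactly one critical value of [f] is also one of [g], the pair is in the position excluded by
   [exn_absurd]. *)
have absurd v1 v2 : v1 <> v2 -> isV A v1 -> isV A v2 -> isV A' v1 -> ~ isV A' v2 -> False.
  move=> n12 V1 V2 V1' nV2; have [g0 goo] := full_exceptional G (full2 _ V2) nV2.
  have fV v : isV A v -> f v = t by case=> ->.
  have gV v : isV A' v -> g v = v2 by case=> ->.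
  have [A1 [B1 X]] := exn_of_pair F n12 V1 V2 (fV _ V1) (fV _ V2) nV.
  have n1t : v1 <> t by move=> E1; apply: nV; rewrite -E1.
  have [A2 [B2 X']] := exn_of_pair G n1t V1' Vt (gV _ V1') (gV _ Vt) nV2.
  exact: exn_absurd X X' (isT : 0 < k.+1)%N E.
have V0 : isV A (A s0) by left.
have Voo : isV A (A soo) by right.
have [V0'|nV0] := isV_dec A' (A s0); have [Voo'|nVoo] := isV_dec A' (A soo).
- apply: nV; rewrite /isV.
  by case: Vt V0' Voo' => -> [] E0 [] Eoo; rewrite ?E0 ?Eoo; [case: nA; rewrite E0 Eoo|left|right|case: nA; rewrite E0 Eoo|case: nA; rewrite E0 Eoo|right|left|case: nA; rewrite E0 Eoo].
- exact: absurd nA V0 Voo V0' nVoo.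
- exact: absurd (nesym nA) Voo V0 Voo' nV0.
(* If neither is, [g] would send the same critical value to both [A s0] and [A soo]. *)
have [g0 _] := full_exceptional G (full2 _ V0) nV0.
have [goo _] := full_exceptional G (full2 _ Voo) nVoo.
by apply: nA; rewrite -g0 goo.
Qed.

(** Such an [s] is [w z] or [w / z], and a [d]-th root of [w] lifts it. *)
Lemma pow_lift d s : (0 < d)%N -> Mob s -> s s0 = s0 \/ s s0 = soo ->
  s soo = s0 \/ s soo = soo ->
  exists2 N, Mob N & forall z, s (powS d z) = powS d (N z).
Proof.
move=> d0 Ms H0 Hoo.
have ns : s s0 <> s soo by move/(Mob_inj Ms).
have rt (w : K) : w != 0 -> exists2 r : K, r != 0 & r ^+ d = w.
  move=> w0; have [r rd] := rootK w d0; exists r => //.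
  by apply: contraNneq w0 => r0; rewrite -rd r0 expr0n eqn0Ngt d0.
case: H0 Hoo ns => E0 [] Eoo ns; try by case: ns; rewrite E0 Eoo.
  have [w /rt[r r0 <-] E] := Mob_fix0oo Ms E0 Eoo.
  by exists (scal r); [exact: Mob_scal|move=> z; rewrite E pow_scal].
have [w /rt[r r0 <-] E] := Mob_swap0oo Ms E0 Eoo.
exists (fun z => scal r (sinv z)); first exact: Mob_comp (Mob_scal r0) (Mob_sinv K).
by move=> z; rewrite E pow_scal // pow_sinv.
Qed.

(** Comparing the outer factors leaves a Moebius map preserving the pair of [0] and infinity, which
    [pow_lift] moves past the power map. *)
Lemma nf_factor d f g A B A' B' : (0 < d)%N -> nf d f A B -> nf d g A' B' ->
  (forall t, isV A' t -> isV A t) -> exists2 M, Mob M & forall z, g z = f (M z).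
Proof.
move=> d0 [MA MB Ef] [MA' MB' Eg] H.
have [A2 [MA2 AA' A'A]] := Mob_inv MA; have [B2 [MB2 BB' B'B]] := Mob_inv MB.
have H' z : isV A' (A' z) -> A2 (A' z) = s0 \/ A2 (A' z) = soo.
  by move/H => [] ->; rewrite AA'; [left|right].
have [||N MN EN] := @pow_lift d (fun z => A2 (A' z)) d0 (Mob_comp MA2 MA').
- by apply: H'; left.
- by apply: H'; right.
exists (fun z => B2 (N (B' z))); first exact: Mob_comp MB2 (Mob_comp MN MB').
by move=> z; rewrite Ef B'B -EN A'A Eg.
Qed.

Lemma swap_pair (N : sphere K -> sphere K) a b : injective N -> a <> b ->
  N a = a \/ N a = b -> N b = a \/ N b = b -> N (N a) = a.
Proof.
move=> iN ab [] Ea [] Eb; rewrite ?Ea ?Eb //.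
by case: ab; apply: iN; rewrite Ea Eb.
Qed.

(** * Symmetries of the iterates of a map in normal form *)

Section Core.
Variables (d k : nat) (f A B : sphere K -> sphere K) (c : sphere K).
Hypotheses (d2 : (2 <= d)%N) (de : ~~ odd d) (F : nf d f A B) (k0 : (0 < k)%N).
Hypotheses (Cc : B c = s0 \/ B c = soo) (nVc : ~ isV A c).

Let d0 : (0 < d)%N. Proof. exact: leq_trans d2. Qed.
Let MA : Mob A. Proof. by case: F. Qed.
Let MB : Mob B. Proof. by case: F. Qed.
Let fE z : f z = A (powS d (B z)). Proof. by case: F. Qed.
Let f_onto w : exists z, f z = w.
Proof. exact: (nf_onto d0 F (fun w => ex_intro _ w erefl)). Qed.

Definition shares M := Mob M /\ forall z, iter k (fun w => M (f w)) z = iter k f z.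

Lemma share_factor M : Mob M -> (forall z, iter k f z = iter k (fun w => f (M w)) z) ->
  exists2 N, shares N & forall z, f (N z) = f (M z).
Proof.
move=> MM E.
have Rf phi : ratl phi -> ratl (fun z => f (phi z)) by apply: (nf_ratl d0 F).
have [N [MN H1 H2 _]] := share Rf (galois_nf d0 F) MM k0 E.
by exists N.
Qed.

(** [M f] is again in normal form, its critical values being the [M]-images of those of [f], and
    [critical_values] compares the two. *)
Lemma shares_isV M z : shares M -> isV A z -> isV A (M z).
Proof.
move=> [MM E] Vz; have [MA1 MB1 E1] := F.
have F' : nf d (fun z => M (f z)) (fun z => M (A z)) B.
  by split=> //; [exact: Mob_comp|move=> w; rewrite fE].
apply: (critical_values d2 de F F' k0); first by move=> w; rewrite E.
by case: Vz => ->; [left|right].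
Qed.

(** [N] permutes the critical values, because it shares the iterate, and the critical points,
    because it lifts [M]. Its square therefore fixes both critical values and [c], three distinct
    points. *)
Lemma shares_lift M : shares M -> exists N, [/\ shares N,
  forall z, M (f z) = f (N z), forall z, isV A (f z) -> isV A (f (N z))
  & forall z, N (N z) = z].
Proof.
move=> SM; have [MM E] := SM.
have F' : nf d (fun z => M (f z)) (fun z => M (A z)) B.
  by split=> //; [exact: Mob_comp|move=> w; rewrite fE].
have [t|N0 MN0 E0] := nf_factor d0 F F'.
  by case=> ->; apply: shares_isV => //; [left|right].
have [|N SN E1] := share_factor MN0.
  by move=> z; rewrite -E; apply: iter_ext.
have EN z : M (f z) = f (N z) by rewrite E1 E0.
have CN z : isV A (f z) -> isV A (f (N z)) by rewrite -EN; apply: shares_isV.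
exists N; split=> //; have [MN _] := SN; have iN := Mob_inj MN.
have nA : A s0 <> A soo by move/(Mob_inj MA).
have V0 : isV A (A s0) by left.
have Voo : isV A (A soo) by right.
have NVz : N (N (A s0)) = A s0.
  by apply: (@swap_pair N _ (A soo)) => //; apply: shares_isV.
have Noo : N (N (A soo)) = A soo.
  apply: (@swap_pair N _ (A s0)) => //; first exact: nesym.
    by case: (shares_isV SN Voo); [right|left].
  by case: (shares_isV SN V0); [right|left].
have Nc : N (N c) = c.
  have [c' [cc' Cc' HC]] : exists c', [/\ c <> c', isV A (f c')
      & forall z, isV A (f z) -> z = c \/ z = c'].
    have [B2 [MB2 BB' B'B]] := Mob_inv MB.
    case: Cc => Ec; [exists (B2 soo)|exists (B2 s0)]; split.
    - by move=> E'; move: Ec; rewrite E' B'B.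
    - by apply/(nf_isV d0 F); right; rewrite B'B.
    - move=> z /(nf_isV d0 F)[] Ez; last by right; rewrite -Ez BB'.
      by left; apply: (Mob_inj MB); rewrite Ec Ez.
    - by move=> E'; move: Ec; rewrite E' B'B.
    - by apply/(nf_isV d0 F); left; rewrite B'B.
    - move=> z /(nf_isV d0 F)[] Ez; first by right; rewrite -Ez BB'.
      by left; apply: (Mob_inj MB); rewrite Ec Ez.
  apply: (@swap_pair N _ c') => //.
    by apply/HC/CN; apply/(nf_isV d0 F).
  exact/HC/CN.
apply: (@Mob_fix3 _ (fun z => N (N z)) (A s0) (A soo) c) => //.
- exact: Mob_comp.
- by move=> E'; apply: nVc; rewrite -E'.
- by move=> E'; apply: nVc; rewrite -E'.
Qed.

Lemma shared_iterate_involution g A' B' : nf d g A' B' -> (forall z, iter k f z = iter k g z) ->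
  ~ (forall z, f z = g z) ->
  exists mu, [/\ Mob mu, forall z, mu (mu z) = z, ~ (forall z, mu z = z),
    forall z, g z = mu (f z) & forall z, g z = f (mu z)].
Proof.
move=> G E nfg.
have [B2 [MB2 BB' B'B]] := Mob_inv MB.
pose c1 := B2 s0; pose c2 := B2 soo.
have c12 : c1 <> c2 by move/(Mob_inj MB2).
have Cf z : isV A (f z) -> z = c1 \/ z = c2.
  by move/(nf_isV d0 F) => [] Ez; [left|right]; rewrite -[z]BB' Ez.
have C1 : isV A (f c1) by apply/(nf_isV d0 F); left; rewrite B'B.
have C2 : isV A (f c2) by apply/(nf_isV d0 F); right; rewrite B'B.
have fc1 : f c1 = A s0 by rewrite fE B'B pow0.
have fc2 : f c2 = A soo by rewrite fE B'B.
have [t Vt|M1 MM1 E1] := nf_factor d0 F G; first exact: critical_values d2 de F G k0 E Vt.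
have [|M SM fM] := share_factor MM1; first by move=> z; rewrite E; apply: iter_ext.
have gM z : g z = f (M z) by rewrite fM E1.
have [MM _] := SM.
(* [d] is even, so an involution fixing both critical points is a deck transformation of [f] *)
have deck N : Mob N -> (forall z, isV A (f z) -> isV A (f (N z))) ->
    (forall z, N (N z) = z) -> N c1 = c1 -> forall z, f (N z) = f z.
  move=> MN CN NN N1.
  have N2 : N c2 = c2.
    by case: (Cf _ (CN _ C2)) => // N2; case: c12; apply: (Mob_inj MN); rewrite N1 N2.
  have MBN : Mob (fun z => B (N (B2 z))) by apply: Mob_comp MB (Mob_comp MN MB2).
  have [||w w0 Ew] := Mob_fix0oo MBN.
  - by rewrite -/c1 N1 B'B.
  - by rewrite -/c2 N2 B'B.
  have w2 : w ^+ 2 = 1.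
    have := Ew (B (N (B2 s1))); rewrite BB' NN B'B Ew !scal_some mulr1 => -[->].
    by rewrite expr2.
  have wd : w ^+ d = 1.
    by rewrite -(odd_double_half d) (negPf de) add0n -mul2n exprM w2 expr1n.
  move=> z; rewrite !fE; congr A; have := Ew (B z); rewrite BB' => ->.
  by rewrite pow_scal // wd; case: (powS d _) => [x|]; rewrite ?scaloo // scal_some mul1r.
(* If the lift fixed [c1], then [deck] would give [L f = f], and [L] would be the identity. *)
have lift1 L : shares L -> ~ (forall z, L z = z) -> exists N, [/\ shares N,
    forall z, L (f z) = f (N z), forall z, N (N z) = z, N c1 = c2 & N c2 = c1].
  move=> SL nL; have [N [SN EN CN NN]] := shares_lift SL; have [MN _] := SN.
  have N1 : N c1 = c2.
    case: (Cf _ (CN _ C1)) => // N1; case: nL => z.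
    by have [w <-] := f_onto z; rewrite EN deck.
  by exists N; split=> //; rewrite -N1 NN.
have notid N : N c1 = c2 -> ~ (forall z, N z = z) by move=> N1 I; apply: c12; rewrite -N1 I.
have nM : ~ (forall z, M z = z) by move=> I; apply: nfg => z; rewrite gM I.
(* Each lift shows how the previous map acts on the critical values: as [N f = f N'] and [N']
   exchanges the critical points, [N] exchanges the critical values. In the same way [N''] serves
   [N']. *)
have [N [SN EN NN N1 N2]] := lift1 M SM nM.
have [N' [SN' EN' NN' N'1 N'2]] := lift1 N SN (notid _ N1).
have [N'' [_ EN'' _ N''1 N''2]] := lift1 N' SN' (notid _ N'1).
have NA0 : N (A s0) = A soo by rewrite -fc1 EN' N'1 fc2.
have NAoo : N (A soo) = A s0 by rewrite -fc2 EN' N'2 fc1.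
have N'A0 : N' (A s0) = A soo by rewrite -fc1 EN'' N''1 fc2.
have N'Aoo : N' (A soo) = A s0 by rewrite -fc2 EN'' N''2 fc1.
have [MN _] := SN; have [MN' _] := SN'.
have Nc : N c = N' c.
  have /Cf[] : isV A (f c) by apply/(nf_isV d0 F).
    by move=> ->; rewrite N1 N'1.
  by move=> ->; rewrite N2 N'2.
have EqN : forall z, N z = N' z.
  apply: (@Mob_eq3 _ N N' (A s0) (A soo) c) => //; rewrite ?NA0 ?NAoo //.
  - by move/(Mob_inj MA).
  - by move=> E'; apply: nVc; rewrite -E'; left.
  - by move=> E'; apply: nVc; rewrite -E'; right.
(* [M f = f N = f N' = N f], and [f] is onto. *)
have EqM z : M z = N z by have [w <-] := f_onto z; rewrite EN EN' EqN.
exists N; split=> //; first exact: notid.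
  by move=> z; rewrite gM EqM -EN EqM.
by move=> z; rewrite gM EqM.
Qed.

End Core.
End SharedIterate.

(** * Bicritical maps in normal form *)

Section NormalForm.
Variable K : numClosedFieldType.
Implicit Types (z t : sphere K) (p q P Q S T : {poly K}).
Implicit Types (f g m A B : sphere K -> sphere K).

Local Notation s0 := (s0 K).
Local Notation s1 := (s1 K).
Local Notation soo := (soo K).

Lemma reval_some P Q x : reval P Q (Some x) = pt P.[x] Q.[x].
Proof. by []. Qed.

Lemma reval_oo P Q : reval P Q None = pt P`_(rdeg P Q) Q`_(rdeg P Q).
Proof. by []. Qed.

Lemma Mob_is_mobius m : Mob m -> is_mobius m.
Proof.
move=> [a [b [c [e [D E]]]]].
pose P : {poly K} := a *: 'X + b *: 1; pose Q : {poly K} := c *: 'X + e *: 1.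
have sz (u v : K) : (size (u *: 'X + v *: 1 : {poly K})%R <= 2)%N.
  rewrite (leq_trans (size_polyD _ _)) // geq_max !(leq_trans (size_scale_leq _ _)) ?size_polyX //.
  by rewrite size_poly1.
have c1 (u v : K) : (u *: 'X + v *: 1 : {poly K})`_1 = u.
  by rewrite coefD !coefZ coefX coefC /= mulr1 mulr0 addr0.
have big (p : {poly K}) : p`_1 != 0 -> (1 < size p)%N.
  by rewrite ltnNge; apply: contraNN => s; rewrite nth_default.
have dg : rdeg P Q = 1.
  rewrite /rdeg; suff -> : maxn (size P) (size Q) = 2 by [].
  apply/eqP; rewrite eqn_leq geq_max !sz /= leq_max.
  have [a0|a0] := eqVneq a 0; last by rewrite big ?c1.
  rewrite orbC big // c1; apply: contraNneq D => c0.
  by rewrite a0 c0 mul0r mulr0 subr0.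
exists P, Q; split; first by apply: coprime_lin => //; rewrite coprimep1.
split=> // -[x|]; rewrite E.
  by rewrite reval_some /mob /P /Q !hornerE.
by rewrite reval_oo dg !c1 /mob /= !mulr1 !mulr0 !addr0.
Qed.

Lemma reval_Xn d z : (0 < d)%N -> reval 'X^d 1 z = powS d z.
Proof.
case: z => [x|] d0; first by rewrite reval_some !hornerE /pt oner_eq0 divr1.
have -> : reval 'X^d 1 None = pt ('X^d : {poly K})`_d (1 : {poly K})`_d.
  by rewrite reval_oo /rdeg size_polyXn size_poly1 (maxn_idPl _).
by rewrite coefXn coef1 eqxx (gtn_eqF d0) /pt eqxx.
Qed.

Lemma reval_Vn d z : (0 < d)%N -> reval 1 'X^d z = sinv (powS d z).
Proof.
move=> d0; case: z => [x|].
  by rewrite reval_some !hornerE /= -[Some _]pt_h sinv_pt ?nz_h.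
rewrite reval_oo /rdeg size_polyXn size_poly1 (maxn_idPr _) //.
by rewrite coefXn coef1 eqxx (gtn_eqF d0) /pt oner_eq0 mul0r /= sinvoo.
Qed.

(** If both critical points are critical values, [r] preserves the pair of [0] and infinity, so it
    is [w z] or [w / z], and a suitable scaling conjugates [f] to a power map. *)
Lemma not_power_crit d f A B : (2 <= d)%N -> nf d f A B -> ~ power_map d f ->
  exists c, (B c = s0 \/ B c = soo) /\ ~ isV A c.
Proof.
move=> d2 [MA MB E] np; have d0 : (0 < d)%N by apply: leq_trans d2.
have [A2 [MA2 AA' A'A]] := Mob_inv MA; have [B2 [MB2 BB' B'B]] := Mob_inv MB.
have [V0|nV] := isV_dec A (B2 s0); last by exists (B2 s0); rewrite B'B; split=> //; left.
have [Voo|nV] := isV_dec A (B2 soo); last by exists (B2 soo); rewrite B'B; split=> //; right.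
case: np; pose r z := A2 (B2 z); have Mr : Mob r by apply: Mob_comp.
have BE z : B2 z = A (r z) by rewrite A'A.
have nr : r s0 <> r soo by move/(Mob_inj Mr).
have root n (w : K) : (0 < n)%N -> w != 0 -> exists2 u : K, u != 0 & u ^+ n = w.
  move=> n0 w0; have [u un] := rootK w n0; exists u => //.
  by apply: contraNneq w0 => u0; rewrite -un u0 expr0n eqn0Ngt n0.
have rE z : isV A (B2 z) -> r z = s0 \/ r z = soo.
  by rewrite /r => -[] ->; rewrite AA'; [left|right].
have [] := rE _ V0 => R0; have [] := rE _ Voo => Roo; try by case: nr; rewrite R0 Roo.
  have [w w0 Ew] := Mob_fix0oo Mr R0 Roo.
  (* The conjugacy requires [u^d = w u]; in the other case below it requires [u^d = w / u]. *)
  have [|u u0 Eu] := root d.-1 w _ w0; first by case: d d2 {E d0} => [|[]].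
  exists (fun z => B2 (scal u z)); split.
    exact/Mob_is_mobius/(Mob_comp MB2 (Mob_scal u0)).
  left=> z; rewrite reval_Xn // E B'B BE Ew pow_scal //; congr A.
  case: (powS d z) => [x|]; rewrite ?scaloo // !scal_some; congr Some.
  by rewrite mulrA -Eu -exprSr prednK.
have [w w0 Ew] := Mob_swap0oo Mr R0 Roo.
have [|u u0 Eu] := root d.+1 w _ w0; first by [].
exists (fun z => B2 (scal u z)); split.
  exact/Mob_is_mobius/(Mob_comp MB2 (Mob_scal u0)).
right=> z; rewrite reval_Vn // E B'B BE Ew pow_scal //; congr A.
rewrite -[powS d z]pt_h; have := nz_h (powS d z); move: (hn _) (hd _) => a b H.
have H' : nz b a by move: H; rewrite /nz orbC.
have H2 : nz (u * b) a by move: H'; rewrite /nz mulf_eq0 negb_or u0.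
rewrite (sinv_pt H) (scal_pt _ H) (scal_pt _ H') (sinv_pt H2) scal_pt; last by move: H2; rewrite /nz orbC.
by rewrite -[LHS](ptZ _ _ u0) -Eu exprS; congr pt; ring.
Qed.

(** * Wronskians and ramification *)

Definition wrons p q := p^`() * q - p * q^`().

(** In characteristic zero differentiation lowers the order of vanishing by exactly one: the
    cofactor takes the value [(e + 1) U q] at [x]. *)
Lemma wrons_mult p q U x e : p = U * ('X - x%:P) ^+ e.+1 -> ~~ root U x -> ~~ root q x ->
  exists2 V, ~~ root V x & wrons p q = V * ('X - x%:P) ^+ e.
Proof.
move=> -> rU rq.
exists (U * q *+ e.+1 + ('X - x%:P) * (U^`() * q - U * q^`())).
  rewrite /root hornerD hornerMn hornerM [X in _ + X]hornerM hornerXsubC subrr mul0r addr0.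
  by rewrite mulrn_eq0 mulf_eq0 /= negb_or; apply/andP.
rewrite /wrons derivM deriv_exp derivXsubC mul1r /= exprS.
by rewrite -mulr_natr -[_ *+ e.+1 in RHS]mulr_natr; ring.
Qed.

Lemma coef_top p q (m n : nat) : (size p <= m.+1)%N -> (size q <= n.+1)%N ->
  (p * q)`_(m + n) = p`_m * q`_n.
Proof.
move=> sp sq; rewrite coefM.
have mn : (m < (m + n).+1)%N by rewrite ltnS leq_addr.
rewrite (bigD1 (Ordinal mn)) //= addKn big1 ?addr0 // => i ne.
have [im|im] := ltnP i m.
  by rewrite (nth_default _ (leq_trans sq _)) ?mulr0 //; lia.
rewrite nth_default ?mul0r // (leq_trans sp) // ltn_neqAle im andbT.
by apply: contraNneq ne => E; apply/eqP/val_inj.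
Qed.

(* The top coefficient of the Wronskian is [(deg p - deg q)] times the product of the leading
   coefficients, up to sign. *)
Lemma wrons_size p q s d : size p = s.+1 -> (s < d)%N -> size q = d.+1 ->
  size (wrons p q) = (s + d)%N.
Proof.
move=> sp sd sq.
pose W := 'X * wrons p q.
(* With the factor [X], each derivative becomes the operator multiplying the coefficient of index
   [n] by [n], so indices do not shift. *)
have WE : W = ('X * p^`()) * q - p * ('X * q^`()) by rewrite /W /wrons; ring.
have szX (r : {poly K}) n : size r = n.+1 -> (size ('X * r^`())%R <= n.+1)%N.
  move=> sr; have [->|r0] := eqVneq r^`() 0; first by rewrite mulr0 size_poly0.
  rewrite mulrC size_mulX // -sr; apply: lt_size_deriv.
  by rewrite -size_poly_eq0 sr.
have cX (r : {poly K}) n : ('X * r^`())`_n = r`_n *+ n.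
  by rewrite coefXM coef_deriv; case: n => [|n] //=; rewrite mulr0n.
have szp := szX _ _ sp; have szq := szX _ _ sq.
have cW : W`_(s + d) != 0.
  rewrite WE coefB !coef_top ?sp ?sq // !cX mulrnAl mulrnAr.
  have lp : p`_s != 0 by have := lead_coef_eq0 p; rewrite /lead_coef sp /= => ->; rewrite -size_poly_eq0 sp.
  have lq : q`_d != 0 by have := lead_coef_eq0 q; rewrite /lead_coef sq /= => ->; rewrite -size_poly_eq0 sq.
  rewrite -opprB oppr_eq0 -mulrnBr ?(ltnW sd) // mulrn_eq0 mulf_eq0 !negb_or lp lq.
  by rewrite subn_eq0 -ltnNge sd.
have szW : size W = (s + d).+1.
  apply/eqP; rewrite eqn_leq; apply/andP; split; last first.
    by rewrite ltnNge; apply: contraNN cW => ?; rewrite nth_default.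
  rewrite WE (leq_trans (size_polyD _ _)) // geq_max size_polyN.
  apply/andP; split; apply: leq_trans (size_polyMleq _ _) _.
    by rewrite sq addnS /= -addSn leq_add2r.
  by rewrite sp addSn /= -addnS leq_add2l.
have W0 : wrons p q != 0.
  by apply: contraTneq cW => W0; rewrite /W W0 mulr0 coef0 eqxx.
by move: szW; rewrite /W mulrC size_mulX // => -[].
Qed.

Section Local.
Variables (d : nat) (P Q : {poly K}) (f : sphere K -> sphere K).
Hypotheses (d2 : (2 <= d)%N) (cPQ : coprimep P Q) (dPQ : rdeg P Q = d).
Hypothesis fE : forall z, f z = reval P Q z.

Let W := wrons P Q.
Let form w := lin P Q (hn w) (hd w).
(** A partner that gives [form w] the Wronskian [W] and does not vanish on the affine fibre over
    [w]. *)
Let companion (w : sphere K) := if w is Some _ then Q else P.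

Let W_form w : W = wrons (form w) (companion w).
Proof.
case: w => [a|]; rewrite /form /lin /= /W /wrons.
  by rewrite scale1r derivB derivZ -!mul_polyC; ring.
by rewrite scale0r sub0r scale1r derivN; ring.
Qed.

Let form_fiber w : exists2 u : K, u != 0 & fiberpoly P Q w = u *: form w.
Proof.
case: w => [a|]; rewrite /form /lin /=.
  by exists 1; rewrite ?oner_eq0 // !scale1r mul_polyC.
exists (-1); rewrite ?oppr_eq0 ?oner_eq0 // scale0r sub0r !scale1r.
by rewrite scaleNr scale1r opprK.
Qed.

Let szP : (size P <= d.+1)%N.
Proof. by rewrite -dPQ /rdeg; apply: leq_trans (leqSpred _); apply: leq_maxl. Qed.
Let szQ : (size Q <= d.+1)%N.
Proof. by rewrite -dPQ /rdeg; apply: leq_trans (leqSpred _); apply: leq_maxr. Qed.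

Let szmax : maxn (size P) (size Q) = d.+1.
Proof. by move: d2; rewrite -dPQ /rdeg; case: (maxn _ _). Qed.

Let nz_top : nz P`_d Q`_d.
Proof.
rewrite /nz; have [szp|szq] : size P = d.+1 \/ size Q = d.+1.
- by move: szmax; rewrite /maxn; case: ifP => _; [right|left].
- have := lead_coef_eq0 P; rewrite /lead_coef szp /= => ->.
  by rewrite -size_poly_eq0 szp.
have := lead_coef_eq0 Q; rewrite /lead_coef szq /= => ->.
by rewrite -[Q == 0]size_poly_eq0 szq orbT.
Qed.

Let size_form w : (size (form w) <= d.+1)%N.
Proof.
rewrite /form /lin (leq_trans (size_polyD _ _)) // geq_max size_polyN.
by rewrite !(leq_trans (size_scale_leq _ _)).
Qed.

Let form_neq0 w : form w != 0.
Proof.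
apply/eqP => E; move: cPQ; rewrite /form /lin in E; case: w E => [a|] /=.
  rewrite scale1r => /eqP; rewrite subr_eq0 => /eqP PE; rewrite PE coprimep_sym.
  move=> c; have : size Q == 1 by rewrite -coprimepp; case: (eqVneq a 0) c => [->|a0];
    [rewrite scale0r coprimep0 coprimepp size_poly_eq1|rewrite coprimepZr].
  move=> /eqP sQ; move: szmax; rewrite PE sQ => H.
  have := size_scale_leq a Q; rewrite sQ => /maxn_idPr E.
  by move: d2; rewrite E in H; case: H => <-.
rewrite scale0r sub0r scale1r => /eqP; rewrite oppr_eq0 => /eqP Q0.
rewrite Q0 coprimep0 -size_poly_eq1 => /eqP sP.
by move: szmax d2; rewrite Q0 size_poly0 sP => -[<-].
Qed.

Let f_some x : f (Some x) = pt P.[x] Q.[x]. Proof. by rewrite fE. Qed.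

Let form_root x : root (form (f (Some x))) x.
Proof.
rewrite /form /lin /root hornerD hornerN !hornerZ subr_eq0; apply/eqP.
rewrite f_some; have [c c0 []] := pt_lift (coprime_nz x cPQ).
by move: (pt _ _) => w -> ->; ring.
Qed.

Let companion_root x : ~~ root (companion (f (Some x))) x.
Proof.
rewrite f_some /pt; case: eqP => [Q0|/eqP Q0] //=.
by have := coprime_nz x cPQ; rewrite /nz Q0 eqxx orbF.
Qed.

(** The fibre form vanishes at [x] to order [mup x W + 1], which is at most [d]; at order [d] its
    cofactor is constant. *)
Lemma local_mult x : [/\ (mup x W < d)%N,
  (0 < mup x W)%N -> is_critical f (Some x)
  & mup x W = d.-1 -> exists2 u : K, u != 0 & form (f (Some x)) = u *: ('X - x%:P) ^+ d].
Proof.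
set S := form (f (Some x)); have S0 : S != 0 := form_neq0 _.
have [m [U]] := multiplicity_XsubC S x; rewrite S0 /= => rU ES.
have U0 : U != 0 by apply: contraNneq S0 => U0; rewrite ES U0 mul0r.
case: m ES => [|e] ES.
  by have := form_root x; rewrite -/S ES expr0 mulr1 (negPf rU).
have [V rV EW] := wrons_mult ES rU (companion_root x); rewrite -W_form in EW.
have mW : mup x W = e by rewrite EW mupMr // mup_XsubCX eqxx.
have szS : (size U + e <= d)%N.
  have := size_form (f (Some x)); rewrite -/S ES size_mul ?expf_neq0 ?polyXsubC_eq0 //.
  by rewrite size_exp_XsubC !addnS /= ltnS.
have U1 : (0 < size U)%N by rewrite size_poly_gt0.
rewrite mW; split; first by apply: leq_trans szS; rewrite -[e.+1]add1n leq_add2r.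
  move=> e0; exists P, Q; split=> //; split=> //.
  rewrite /locdeg -fE; have [u u0 ->] := form_fiber (f (Some x)).
  rewrite mup_geq ?scaler_eq0 ?negb_or ?u0 ?form_neq0 // dvdpZr // -/S ES.
  by rewrite dvdp_mull // dvdp_exp2l.
move=> ed; have dd : d = d.-1.+1 by rewrite prednK // (ltnW d2).
have sU : (size U <= 1)%N by move: szS; rewrite ed {2}dd -add1n leq_add2r.
exists U`_0; first by apply: contraNneq U0 => U00; rewrite (size1_polyC sU) U00.
by rewrite ES -mul_polyC -size1_polyC // ed -dd.
Qed.

Let f_oo : f None = pt P`_d Q`_d.
Proof. by rewrite fE reval_oo dPQ. Qed.

Lemma size_form_oo : (size (form (f None)) <= d)%N.
Proof.
have := size_form (f None); rewrite leq_eqVlt ltnS => /orP[/eqP sz|//].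
have : lead_coef (form (f None)) = 0.
  rewrite /lead_coef sz /= /form /lin coefB !coefZ.
  rewrite f_oo; have [c c0 []] := pt_lift nz_top.
  by move: (pt _ _) => w -> ->; ring.
by move/eqP; rewrite lead_coef_eq0 (negPf (form_neq0 _)).
Qed.

(** Riemann-Hurwitz: the degree of [W] is [2 d - 2] less the ramification at infinity, where the
    local degree is [d] minus the degree of the form. *)
Lemma size_W : size W = (size (form (f None)) + d).-1.
Proof.
have sz0 : (0 < size (form (f None)))%N by rewrite size_poly_gt0 form_neq0.
have := size_form_oo; rewrite (W_form (f None)); move: sz0.
case E: (size _) => [|s] // _ sd.
rewrite (wrons_size E sd) //.
have top (p : {poly K}) : (size p <= d.+1)%N -> p`_d != 0 -> size p = d.+1.
  move=> szp pd; apply/eqP; rewrite eqn_leq szp ltnNge.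
  by apply: contraNN pd => ?; rewrite nth_default.
rewrite f_oo /pt; case: eqP => [Q0|/eqP Q0]; apply: top => //.
by have := nz_top; rewrite /nz Q0 eqxx orbF.
Qed.

Let W0 : W != 0.
Proof.
rewrite -size_poly_gt0 size_W.
have : (0 < size (form (f None)))%N by rewrite size_poly_gt0 form_neq0.
by move: (size _) => n n0; rewrite -ltnS prednK ?addn_gt0 ?n0 // (leq_trans d2) // leq_addl.
Qed.

Let oo_critical : (size (form (f None)) < d)%N -> is_critical f None.
Proof.
move=> sz; exists P, Q; split=> //; split=> //.
rewrite /locdeg -fE; have [u u0 ->] := form_fiber (f None).
by rewrite size_scale // dPQ ltn_subRL addn1 ltnS.
Qed.

Let crit_root x : root W x -> is_critical f (Some x).
Proof.
move=> rW; have [_ H _] := local_mult x; apply: H.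
by rewrite mup_geq // expr1 dvdp_XsubCl.
Qed.

Let mup_split p (x : K) : p != 0 -> exists2 q, p = q * ('X - x%:P) ^+ mup x p & ~~ root q x.
Proof.
move=> p0; have [m [q]] := multiplicity_XsubC p x; rewrite p0 /= => rq E.
by exists q => //; rewrite {2}E mupMr // mup_XsubCX eqxx -E.
Qed.

Let no_root p : p != 0 -> (forall x, ~~ root p x) -> size p = 1.
Proof.
move=> p0 H; apply/eqP/negPn/negP => /closed_rootP[x rx].
by move: (H x); rewrite rx.
Qed.

(** Two totally ramified fibres suffice: the quotient of their forms is a constant times the [d]-th
    power of a Moebius map. The case [c = 0] covers a critical point at infinity. *)
Lemma nf_of_forms x1 (c e : K) w1 w2 (u1 u2 : K) : e + x1 * c != 0 ->
  w1 <> w2 -> u1 != 0 -> u2 != 0 -> ((c *: 'X + e *: 1) ^+ d : {poly K})`_d = c ^+ d ->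
  form w1 = u1 *: ('X - x1%:P) ^+ d -> form w2 = u2 *: (c *: 'X + e *: 1) ^+ d ->
  exists A B, nf d f A B.
Proof.
move=> D w12 u10 u20 top F1 F2; have d0 : (0 < d)%N by apply: leq_trans d2.
pose A1 := mob (hd w1) (- hn w1) (hd w2) (- hn w2).
have D1 : hd w1 * - hn w2 - - hn w1 * hd w2 != 0.
  by have := h_neq w12; congr (_ != 0); ring.
pose B := mob 1 (- x1) c e.
have D2 : 1 * e - - x1 * c != 0 by move: D; congr (_ != 0); ring.
have [A2 [MA2 A12 A21]] := Mob_inv (Mob_mob D1 : Mob A1).
have uu : u1 / u2 != 0 by rewrite mulf_neq0 ?invr_eq0.
exists (fun z => A2 (scal (u1 / u2) z)), B; split.
- exact: Mob_comp MA2 (Mob_scal uu).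
- exact: Mob_mob.
have main a b l1 l2 : nz a b -> nz l1 l2 -> hd w1 * a - hn w1 * b = u1 * l1 ^+ d ->
    hd w2 * a - hn w2 * b = u2 * l2 ^+ d ->
    pt a b = A2 (scal (u1 / u2) (powS d (pt l1 l2))).
  move=> nab nl E1 E2; rewrite -[LHS]A12; congr A2.
  rewrite /A1 mob_pt // !mulNr E1 E2 pow_pt // scal_pt ?nz_pow //.
  rewrite -[RHS](ptZ _ _ u20); congr pt; field.
  exact: u20.
case=> [x|].
  rewrite f_some /B -[Some x]pt_h mob_pt ?nz_h //=; apply: main.
  - exact: coprime_nz.
  - by apply: nz_lin => //; rewrite /nz oner_eq0 orbT.
  - have := congr1 (fun p : {poly K} => p.[x]) F1.
    rewrite /form /lin hornerD hornerN !hornerZ horner_exp hornerXsubC => ->.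
    by congr (_ * _ ^+ _); ring.
  have := congr1 (fun p : {poly K} => p.[x]) F2.
  rewrite /form /lin hornerD hornerN !hornerZ horner_exp hornerD !hornerZ hornerX hornerC => ->.
  by congr (_ * _ ^+ _); ring.
rewrite f_oo /B /mob; apply: main.
- exact: nz_top.
- by apply: nz_lin => //; exact: nz_h None.
- have := congr1 (fun p : {poly K} => p`_d) F1.
  rewrite /form /lin coefB !coefZ /= => ->; rewrite !(mulr1, mulr0, addr0) expr1n mulr1.
  have /monicP : ('X - x1%:P) ^+ d \is monic by rewrite monic_exp // monicXsubC.
  by rewrite /lead_coef size_exp_XsubC /= => ->; rewrite mulr1.
have := congr1 (fun p : {poly K} => p`_d) F2.
rewrite /form /lin coefB !coefZ /= => ->; rewrite !(mulr1, mulr0, addr0).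
by rewrite top.
Qed.

Let Xpow (x : K) : (1 *: 'X + (- x) *: 1 : {poly K}) = 'X - x%:P.
Proof. by rewrite scale1r scaleNr -[x%:P]mulr1 mul_polyC. Qed.

(** All roots of [W] are at [x1], with multiplicity below [d]. By [size_W] the multiplicity is
    [d - 1] and the form at infinity is constant, so both fibres are totally ramified. *)
Lemma nf_finite_oo x1 : (forall z, is_critical f z -> z = Some x1 \/ z = None) ->
  exists A B, nf d f A B.
Proof.
move=> H; have [m1 _ L1] := local_mult x1.
have [U EU rU] := mup_split x1 W0.
have U0 : U != 0 by apply: contraNneq W0 => U0; rewrite EU U0 mul0r.
have sU : size U = 1.
  apply: no_root => // x; apply/negP => rx.
  have /H[[Ex]|//] : is_critical f (Some x).
    by apply: crit_root; rewrite EU rootM rx.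
  by move: rU; rewrite -Ex rx.
have sW : size W = (mup x1 W).+1.
  rewrite [in LHS]EU size_mul // ?expf_neq0 ?polyXsubC_eq0 //.
  by rewrite size_exp_XsubC sU.
have s0 : (0 < size (form (f None)))%N by rewrite size_poly_gt0 form_neq0.
have [Em s1] : mup x1 W = d.-1 /\ size (form (f None)) = 1.
  by move: sW; rewrite size_W; split; lia.
have [u u0 F1] := L1 Em.
have F2 : form (f None) = (form (f None))`_0 *: (0 *: 'X + 1 *: 1) ^+ d.
  by rewrite scale0r add0r scale1r expr1n [LHS]size1_polyC ?s1 // -alg_polyC.
have v0 : (form (f None))`_0 != 0.
  by apply: contraNneq (form_neq0 (f None)) => v0; rewrite F2 v0 scaler_eq0 eqxx.
apply: (nf_of_forms _ _ u0 v0 _ F1 F2).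
- by rewrite mulr0 addr0 oner_eq0.
- move=> E; have := form_root x1; rewrite E F2 rootZ // scale0r add0r scale1r expr1n.
  by rewrite (negPf (root1 _)).
rewrite scale0r add0r scale1r expr1n coef1 expr0n.
by case: (d) d2.
Qed.

(** Infinity is unramified, so [W] has degree [2 d - 2], shared between two roots of multiplicity at
    most [d - 1] each. *)
Lemma nf_finite_finite x1 x2 : x1 != x2 ->
  (forall z, is_critical f z -> z = Some x1 \/ z = Some x2) -> exists A B, nf d f A B.
Proof.
move=> n12 H; have [m1 _ L1] := local_mult x1; have [m2 _ L2] := local_mult x2.
have [U EU rU] := mup_split x1 W0.
have U0 : U != 0 by apply: contraNneq W0 => U0; rewrite EU U0 mul0r.
have [V EV rV] := mup_split x2 U0.
have V0 : V != 0 by apply: contraNneq U0 => V0; rewrite EV V0 mul0r.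
have mU : mup x2 W = mup x2 U.
  rewrite EU mupMl // /root horner_exp.
  by rewrite hornerXsubC expf_eq0 subr_eq0 eq_sym (negPf n12) andbF.
have sV : size V = 1.
  apply: no_root => // x; apply/negP => rx.
  have rUx : root U x by rewrite EV rootM rx.
  have /H[[Ex]|[Ex]] : is_critical f (Some x).
    by apply: crit_root; rewrite EU rootM rUx.
    by move: rU; rewrite -Ex rUx.
  by move: rV; rewrite -Ex rx.
have sW : size W = (mup x1 W + mup x2 W).+1.
  rewrite [in LHS]EU size_mul // ?expf_neq0 ?polyXsubC_eq0 // size_exp_XsubC.
  rewrite [in LHS]EV size_mul // ?expf_neq0 ?polyXsubC_eq0 // size_exp_XsubC sV -mU.
  by lia.
have soo : size (form (f None)) = d.
  apply/eqP; rewrite eqn_leq size_form_oo leqNgt; apply/negP => /oo_critical/H.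
  by case.
have [E1 E2] : mup x1 W = d.-1 /\ mup x2 W = d.-1.
  by move: sW; rewrite size_W soo; split; lia.
have [u u0 F1] := L1 E1; have [v v0 F2] := L2 E2.
rewrite -Xpow in F2.
apply: (nf_of_forms _ _ u0 v0 _ F1 F2).
- by rewrite mulr1 addrC subr_eq0.
- move=> E; have := form_root x1; rewrite E F2 rootZ // Xpow /root horner_exp hornerXsubC.
  by rewrite expf_eq0 subr_eq0 (negPf n12) andbF.
rewrite Xpow expr1n.
have /monicP : ('X - x2%:P) ^+ d \is monic by rewrite monic_exp // monicXsubC.
by rewrite /lead_coef size_exp_XsubC.
Qed.

End Local.

Lemma bicritical_nf d f : (2 <= d)%N -> bicritical d f -> exists A B, nf d f A B.
Proof.
move=> d2 [[P [Q [cPQ [dPQ E]]]] [c1 [c2 [c12 H]]]].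
have Hc z : is_critical f z -> z = c1 \/ z = c2 by move/H.
case: c1 c2 c12 {H} Hc => [x1|] [x2|] // c12 Hc.
- apply: (nf_finite_finite d2 cPQ dPQ E _ Hc).
  by apply/eqP => x12; apply: c12; rewrite x12.
- exact: (nf_finite_oo d2 cPQ dPQ E Hc).
by apply: (nf_finite_oo d2 cPQ dPQ E (x1 := x2)) => z /Hc [] ->; [right|left].
Qed.

End NormalForm.

Unset Implicit Arguments.

Theorem theorem2 (R : realType) (d : nat) (f g : sphere R[i] -> sphere R[i]) :
  (2 <= d)%N -> ~~ odd d ->
  bicritical d f -> bicritical d g ->
  ~ power_map d f -> ~ power_map d g ->
  ~ (forall z, f z = g z) ->
  (exists k : nat, (0 < k)%N /\ forall z, iter k f z = iter k g z) ->
  (forall z, iter 2 f z = iter 2 g z) /\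
  exists mu : sphere R[i] -> sphere R[i],
    is_mobius mu /\ (forall z, mu (mu z) = z) /\ ~ (forall z, mu z = z) /\
    (forall z, g z = mu (f z)) /\ (forall z, g z = f (mu z)) /\
    in_Aut f mu /\ in_Aut g mu /\
    symmetry_locus d f /\ symmetry_locus d g.
Proof.
move=> d2 de bf bg nf_ _ nfg [k [k0 E]].
have [A [B F]] := bicritical_nf d2 bf; have [A' [B' G]] := bicritical_nf d2 bg.
have [c [Cc nVc]] := not_power_crit d2 F nf_.
have [mu [Mmu mumu nmu gl gr]] := shared_iterate_involution d2 de F k0 Cc nVc G E nfg.
have comm z : mu (f z) = f (mu z) by rewrite -gl.
have mob := Mob_is_mobius Mmu.
have Af : in_Aut f mu by [].
have Ag : in_Aut g mu by split=> // z; rewrite gl mumu gr mumu.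
split; first by move=> z; rewrite /= gr gl mumu.
have Sf : symmetry_locus d f by split=> //; exists mu.
have Sg : symmetry_locus d g by split=> //; exists mu.
exists mu; exact: conj mob (conj mumu (conj nmu (conj gl (conj gr (conj Af (conj Ag (conj Sf Sg))))))).
Qed.
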